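(* Consider the single-component replacement model described in the context, with parameters $\mu_1,\mu_2,\lambda,\tau>0$ and corrective cost $c_c$, and assume that the preventive replacement costs at scheduled and unscheduled opportunities are equal: $c_p^{\mathrm{so}}=c_p^{\mathrm{uso}}=c_p$ with $0<c_p<c_c$. Then the following policy is long-run average cost optimal. In state $2$: do nothing at every (scheduled or unscheduled) opportunity. In state $1$: replace at every scheduled and at every unscheduled opportunity if $(\mu_1+\mu_2)c_p<\mu_1c_c$, and do nothing at every opportunity otherwise.
   Context: Model. A single component has a fully observable, continuously monitored condition: state $2$ (perfect), state $1$ (satisfactory) or state $0$ (failed). It starts at time $0$ in state $2$. If not replaced, it spends an exponential time with rate $\mu_2$ in state $2$, then moves to state $1$, where it spends an exponential time with rate $\mu_1$, after which it fails. At failure it is instantaneously replaced by an as-good-as-new component (state $2$), at corrective cost $c_c$; hence the condition effectively evolves between states $1$ and $2$. Opportunities. Scheduled opportunities (SO) occur at the deterministic times $\tau,2\tau,3\tau,\dots$. Unscheduled opportunities (USO) occur according to a Poisson process of rate $\lambda$. All sojourn times and the Poisson process are independent. The decision epochs are the SO and USO epochs; at each of them one chooses an action from $\{\text{replace},\text{do nothing}\}$. Replacing instantaneously puts the component in state $2$ (as good as new) at preventive cost $c_p^{\mathrm{so}}$ at an SO and $c_p^{\mathrm{uso}}$ at a USO. Doing nothing costs nothing and leaves the condition unchanged. The costs satisfy $0<c_p^{\mathrm{so}}\le c_p^{\mathrm{uso}}<c_c$. Policies. A policy prescribes an action at each decision epoch as a (measurable) function of the triple $(i,j,t)$, where $i\in\{1,2\}$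 is the current condition, $j\in\{\mathrm{SO},\mathrm{USO}\}$ is the type of opportunity, and $t\in[0,\tau)$ is the remaining time until the next scheduled opportunity (with the convention $t=0$ when $j=\mathrm{SO}$). The long-run average cost of a policy is $\lim_{T\to\infty}\frac1T\,\mathbb{E}[\text{total cost incurred in }[0,T]]$. A policy is long-run average cost optimal if it minimises this quantity among all policies. *)

(* Defs.v *)
From HB Require Import structures.
From mathcomp Require Import all_boot all_order all_algebra.
From mathcomp Require Import all_classical all_reals all_analysis.

Set Implicit Arguments.
Unset Strict Implicit.
Unset Printing Implicit Defensive.

Import Order.TTheory GRing.Theory Num.Theory.
Import numFieldNormedType.Exports.

Local Open Scope classical_set_scope.
Local Open Scope ring_scope.

(* State 2 is [Perfect] and state 1 is [Satisfactory]. A component in state 0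
   is replaced at once, so that no decision is ever taken in that state. *)
Inductive condition := Perfect | Satisfactory.
Inductive opportunity := SO | USO.
Inductive action := Replace | DoNothing.

(* [pi i j t]: action in condition [i], at an opportunity of type [j], when [t]
   is the remaining time until the next scheduled opportunity. Only the values
   at [t] in [0, tau[ are ever used. *)
Definition policy (R : realType) := condition -> opportunity -> R -> action.

Definition measurable_policy (R : realType) (tau : R) (pi : policy R) : Prop :=
  forall i j, measurable [set t : R | 0 <= t < tau /\ pi i j t = Replace].

Section Opportunities.
Context {R : realType}.
Variables (tau : R) (e : nat -> R).

Definition is_so (s : R) : Prop := exists m : nat, s = m.+1%:R * tau.

(* [e n] are the interarrival times of the unscheduled opportunities. *)
Definition is_uso (s : R) : Prop := exists n : nat, s = \sum_(i < n.+1) e i.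

(* Time from [s] to the next multiple of [tau]; it lies in [0, tau[ and is 0
   exactly when [s] is a multiple of [tau]. *)
Definition remaining (s : R) : R := (Num.ceil (s / tau))%:~R * tau - s.

End Opportunities.

(* Trajectory of the system for fixed realisations: component [k] would spend
   [x2 k] in state 2 and then [x1 k] in state 1. Coincidences (of a scheduled
   with an unscheduled opportunity, or of an opportunity with a change of
   condition) are null events for the laws below, so the convention chosen for
   them is immaterial. *)
Section Trajectory.
Context {R : realType}.
Variables (tau cso cuso cc : R) (pi : policy R) (x2 x1 e : nat -> R).

Definition replace_at (i : condition) (s : R) : Prop :=
  (is_so tau s /\ pi i SO 0 = Replace) \/
  (is_uso e s /\ pi i USO (remaining tau s) = Replace).

(* Condition at time [s] of a component that was installed at time [a], has
   sojourn time [y2] in state 2 and is still in use at time [s]. *)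
Definition condition_at (a y2 s : R) : condition :=
  if s < a + y2 then Perfect else Satisfactory.

(* First of the failure time and of the opportunities, after the installation
   at time [a], at which the policy replaces the component. *)
Definition removal_time (a y2 y1 : R) : R :=
  inf ([set a + y2 + y1] `|`
       [set s | a < s < a + y2 + y1 /\ replace_at (condition_at a y2 s) s]).

Fixpoint install_time (k : nat) : R :=
  if k is k'.+1 then removal_time (install_time k') (x2 k') (x1 k') else 0.

Definition failure_time (k : nat) : R := install_time k + x2 k + x1 k.

(* Cost incurred when component [k] is replaced by component [k.+1]. *)
Definition replacement_cost (k : nat) : R :=
  if install_time k.+1 == failure_time k then cc
  else if `[< is_so tau (install_time k.+1) >] then cso else cuso.

Definition total_cost (T : R) : \bar R :=
  (\sum_(k <oo | (install_time k.+1 <= T)%R) (replacement_cost k)%:E)%E.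

End Trajectory.

Section RandomModel.
Context {R : realType} {d : measure_display} {Omega : measurableType d}.
Variable P : probability Omega R.

Definition has_exponential_law (rate : R) (X : {RV P >-> R}) : Prop :=
  forall A : set R, measurable A ->
    distribution P X A = exponential_prob rate A.

Definition mutually_independent (I : eqType) (X : I -> {RV P >-> R}) : Prop :=
  forall (J : seq I) (A : I -> set R), uniq J ->
    (forall i, measurable (A i)) ->
    P (\bigcap_(i in [set` J]) (X i @^-1` A i)) =
    (\prod_(i <- J) P (X i @^-1` A i))%E.

(* The unscheduled opportunities form a Poisson process of rate [lam], given
   by its independent exponential interarrival times [E n]. *)
Definition replacement_model (mu1 mu2 lam : R)
    (X2 X1 E : nat -> {RV P >-> R}) : Prop :=
  [/\ forall k, has_exponential_law mu2 (X2 k),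
      forall k, has_exponential_law mu1 (X1 k),
      forall n, has_exponential_law lam (E n)
    & mutually_independent (fun i : nat + nat + nat =>
        match i with
        | inl (inl k) => X2 k
        | inl (inr k) => X1 k
        | inr n => E n
        end)].

Variables (tau cso cuso cc : R) (X2 X1 E : nat -> {RV P >-> R}).

Definition expected_cost (pi : policy R) (T : R) : \bar R :=
  (\int[P]_w total_cost tau cso cuso cc pi
     (fun k => X2 k w) (fun k => X1 k w) (fun n => E n w) T)%E.

Definition is_long_run_average_cost (pi : policy R) (g : R) : Prop :=
  (fun T : R => (T^-1)%:E * expected_cost pi T)%E @ +oo --> g%:E.

(* Includes that every policy has a (finite) long-run average cost. *)
Definition long_run_average_cost_optimal (pi : policy R) : Prop :=
  measurable_policy tau pi /\
  exists g : R, is_long_run_average_cost pi g /\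
    forall pi' : policy R, measurable_policy tau pi' ->
      exists g' : R, is_long_run_average_cost pi' g' /\ g <= g'.

End RandomModel.

Definition threshold_policy {R : realType} (mu1 mu2 cp cc : R) : policy R :=
  fun i _ _ =>
    match i with
    | Perfect => DoNothing
    | Satisfactory =>
        if (mu1 + mu2) * cp < mu1 * cc then Replace else DoNothing
    end.

(* Main.v *)
Require Import Defs.
From HB Require Import structures.
From mathcomp Require Import all_boot all_order all_algebra.
From mathcomp Require Import all_classical all_reals all_analysis.
From mathcomp Require Import measurable_realfun ring lra.

Set Implicit Arguments.
Unset Strict Implicit.
Unset Printing Implicit Defensive.

Import Order.TTheory GRing.Theory Num.Theory.
Import numFieldNormedType.Exports.

Local Open Scope classical_set_scope.
Local Open Scope ring_scope.

(** Let [p u] be the probability that the component is in state 1 just before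
    time [u]. All expected costs can be read off this function, because every
    duration of the model is exponential: for an exponential clock of rate [r],
    the probability that it rings at a value having some property equals [r]
    times the expected amount of values with that property that it passes
    before ringing ([compensator]). Isolating the clocks one by one, with all
    the other ones fixed, one obtains that in a set of times [B] the expected
    number of failures is [mu1] times the integral of [p] over [B]
    ([fail_count]), the expected number of moves from state 2 to state 1 is
    [mu2] times the integral of [1 - p] ([wear_count]), and the expected number
    of replacements at unscheduled opportunities is [lam] times an integral of
    [p] or [1 - p] over the times at which the policy replaces ([uso_count],
    [removal_count]). This rests on the fact that the trajectory before a clock
    rings does not depend on when it will ring ([observed_wear],
    [observed_fail], [observed_gap]).

    Balancing the entries into state 1 against the exits from it gives an
    integral equation for [p] ([freq_balance]), whose coefficients have period
    [tau]. Its solutions can be compared ([solution_le]). The component is new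
    at time 0, so the second period starts with at least as much probability of
    state 1 as the first one; by comparison [p (u + tau)] is at least [p u] for
    all [u] ([period_nondecreasing]). Hence the expected cost of a period
    converges with its rank, and every policy has a long-run average cost
    ([period_cost_mean_cvg], [long_run_average]).

    Using the balance once more to eliminate the replacements made in state 1,
    the expected cost up to time [T] becomes, up to a bounded term, the sum of
    [cp * mu2 * T], of [mu1 * cc - (mu1 + mu2) * cp] times the integral of [p],
    and of the nonnegative price of the replacements made in state 2
    ([period_costE]). So one should never replace in state 2. When the
    coefficient is positive the integral of [p] should be as small as possible,
    which is achieved by replacing at every opportunity in state 1
    ([occupation_replace_le]); otherwise it should be as large as possible,
    which is achieved by never replacing ([occupation_never_ge]). *)

(** * Isolating one of infinitely many independent variables *)

Section Isolation.
Context {R : realType} {d : measure_display} {Omega : measurableType d}.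
Variables (P : probability Omega R) (I : eqType) (x : I -> {RV P >-> R}).
Hypothesis indep : mutually_independent x.
Variable j : I.

(** Events that constrain finitely many of the variables other than [x j]. *)
Definition cylinders : set (set Omega) :=
  [set C | exists (J : seq I) (A : I -> set R),
    [/\ uniq J, j \notin J, forall i, measurable (A i) &
        C = \bigcap_(i in [set` J]) (x i @^-1` A i)]].

Local Notation others := (g_sigma_algebraType cylinders).

Lemma cylinders_setI : setI_closed cylinders.
Proof.
move=> C1 C2 [J1 [A1 [u1 j1 m1 ->]]] [J2 [A2 [u2 j2 m2 ->]]].
exists (undup (J1 ++ J2)),
  (fun i => (if i \in J1 then A1 i else setT) `&`
            (if i \in J2 then A2 i else setT)); split.
- exact: undup_uniq.
- by rewrite mem_undup mem_cat negb_or j1.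
- by move=> i; apply: measurableI; case: ifP.
- rewrite eqEsubset; split => w.
    move=> [h1 h2] i /= _; split; case: ifP => // iJ; [exact: h1|exact: h2].
  move=> h; split => i /= iJ.
    have /= := h i; rewrite mem_undup mem_cat iJ => /(_ isT)[].
    by [].
  have /= := h i; rewrite mem_undup mem_cat iJ orbT => /(_ isT)[_].
  by [].
Qed.

Lemma cylinders_measurable : cylinders `<=` measurable.
Proof.
move=> C [J [A [_ _ mA ->]]].
apply: (@fin_bigcap_measurable _ _ _ [set` J]).
  exact: finite_seq.
by move=> i _; rewrite -[_ @^-1` _]setTI; exact: measurable_funP.
Qed.

Lemma measurable_others : measurable_fun setT (id : Omega -> others).
Proof.
move=> _ A mA; rewrite setTI preimage_id.
by apply: (smallest_sub _ cylinders_measurable mA); exact: sigma_algebra_measurable.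
Qed.

Lemma measurable_coordinate_others i : i != j ->
  measurable_fun setT (x i : others -> R).
Proof.
move=> ij _ A mA; rewrite setTI; apply: sub_sigma_algebra.
exists [:: i], (fun=> A); split => //.
  by rewrite inE eq_sym.
rewrite eqEsubset; split => w /=.
  by move=> h k /=; rewrite inE => /eqP ->.
by apply; rewrite /= inE.
Qed.

(** Both sides are finite measures in [C], and mutual independence says that
    they agree on the pi-system of cylinders. *)
Lemma independent_others (B : set R) (C : set Omega) :
  measurable B -> <<s cylinders>> C ->
  P (x j @^-1` B `&` C) = (P (x j @^-1` B) * P C)%E.
Proof.
move=> mB sC.
have mXB : measurable (x j @^-1` B).
  by rewrite -[_ @^-1` _]setTI; exact: measurable_funP.
pose c : {nonneg R} := NngNum (fine_ge0 (measure_ge0 P (x j @^-1` B))).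
have cE : (c%:num)%:E = P (x j @^-1` B).
  by rewrite /= fineK// fin_num_measure.
rewrite setIC -[LHS]/(mrestr P mXB C) -cE -[RHS]/(mscale c P C).
apply: (@g_sigma_algebra_measure_unique _ _ _ cylinders cylinders_measurable
  (fun=> setT)) => //.
- move=> _; exists [::], (fun=> setT); split => //.
  by rewrite eqEsubset; split.
- exact: bigcup_const.
- exact: cylinders_setI.
- move=> A [J [F [uJ jJ mF AE]]].
  suff key : P (A `&` x j @^-1` B) = (P (x j @^-1` B) * P A)%E.
    by rewrite -cE in key; exact: key.
  have := indep (J := j :: J) (A := fun i => if i == j then B else F i).
  rewrite /= jJ uJ big_cons eqxx => /(_ isT) h.
  rewrite [LHS](_ : _ = P (\bigcap_(i in [set` j :: J]) (x i @^-1`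
     (if i == j then B else F i)))); last first.
    congr (P _); rewrite AE eqEsubset; split => w.
      move=> [h1 h2] i /=; rewrite inE => /orP[/eqP ->|iJ]; rewrite ?eqxx//.
      case: eqP => [->//|_]; exact: h1.
    move=> h1; split.
      move=> i /= iJ; have := h1 i; rewrite /= inE iJ orbT => /(_ isT).
      by case: eqP => // ij; rewrite -ij iJ in jJ.
    by have := h1 j; rewrite /= inE eqxx; exact.
  rewrite h; last by move=> i; case: ifP.
  congr (_ * _)%E; rewrite AE indep//.
  rewrite big_seq [RHS]big_seq; apply: eq_bigr => i iJ.
  by case: eqP => // ij; rewrite -ij iJ in jJ.
- move=> _; rewrite /mrestr.
  by rewrite (le_lt_trans (probability_le1 _ _)) ?ltry//; exact: measurableI.
Qed.

Let Pothers : probability others R := distribution P (HB.pack_for {mfun Omega >-> others}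
   (id : Omega -> others) (isMeasurableFun.Build _ _ _ _ _ measurable_others)).

(** Fubini for the product of the law of [x j] and of the joint law of all the
    other variables; the latter is [P] itself, seen on the sigma-algebra that
    these variables generate. *)
Lemma ge0_integral_isolate (F : R * others -> \bar R) :
  measurable_fun setT F -> (forall z, 0 <= F z)%E ->
  (\int[P]_w F (x j w, w) = \int[P]_w' \int[P]_w F (x j w, w'))%E.
Proof.
move=> mF F0.
have mxj : measurable_fun setT (fun w : Omega => (x j w, w : others)).
  apply/measurable_fun_pairP; split => //=; exact: measurable_others.
pose pairing : {mfun Omega >-> (R * others)%type} :=
  HB.pack_for {mfun Omega >-> (R * others)%type}
   (fun w : Omega => (x j w, w : others)) (isMeasurableFun.Build _ _ _ _ _ mxj).
transitivity (\int[distribution P pairing]_z F z)%E.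
  by rewrite ge0_integral_distribution.
transitivity (\int[distribution P (x j) \x Pothers]_z F z)%E.
  apply: eq_measure_integral => A mA _; apply/esym.
  apply: product_measure_unique => //= B C mB mC.
  rewrite /distribution /pushforward/= -independent_others//.
rewrite fubini_tonelli2// /Pothers ge0_integral_distribution//; last 2 first.
  - exact: measurable_fun_fubini_tonelli_G.
  - by move=> y; apply: integral_ge0.
apply: eq_integral => w _ /=.
rewrite /fubini_G ge0_integral_distribution//.
exact: measurable_fun_pair1.
Qed.

End Isolation.

(** * The compensator of an exponential variable *)

Lemma measurable_bool_set d (T : measurableType d) (b : T -> bool) :
  measurable_fun setT b -> measurable [set t | b t].
Proof. by move=> mb; rewrite -[X in measurable X]setTI; exact: (mb _ [set true]). Qed.

Lemma measurable_fun_in d (T : measurableType d) (C : set T) :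
  measurable C -> measurable_fun setT (fun t => t \in C).
Proof.
move=> mC; apply: (@measurable_fun_bool _ _ _ _ true).
rewrite setTI (_ : _ @^-1` _ = C)// eqEsubset; split => t /=.
  by move/set_mem.
by move/mem_set.
Qed.

Lemma measurable_natr_bool {R : realType} d (T : measurableType d) (b : T -> bool) :
  measurable_fun setT b -> measurable_fun setT (fun t => (b t)%:R : R).
Proof.
move=> mb; have -> : (fun t => (b t)%:R) = \1_[set t | b t] :> (T -> R).
  by apply/funext => t; rewrite indicE; congr (_%:R); congr nat_of_bool;
    apply/idP/idP => [?|/set_mem//]; apply/mem_set.
by apply: measurable_indic; exact: measurable_bool_set.
Qed.

Section Tonelli.
Context {R : realType} d1 d2 (T1 : measurableType d1) (T2 : measurableType d2).
Variables (m1 : {sigma_finite_measure set T1 -> \bar R})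
  (m2 : {sigma_finite_measure set T2 -> \bar R}) (b : T1 * T2 -> bool).
Hypothesis mb : measurable_fun setT b.

Let xsec s : xsection [set z | b z] s = [set t | b (s, t)].
Proof.
by rewrite eqEsubset; split => t; rewrite /xsection/= ?in_setE//= => h; rewrite in_setE.
Qed.

Let ysec t : ysection [set z | b z] t = [set s | b (s, t)].
Proof.
by rewrite eqEsubset; split => s; rewrite /ysection/= ?in_setE//= => h; rewrite in_setE.
Qed.

Lemma tonelli_bool :
  (\int[m1]_s m2 [set t | b (s, t)] = \int[m2]_t m1 [set s | b (s, t)])%E.
Proof.
transitivity ((m1 \x m2) [set z | b z])%E.
  by apply: eq_integral => s _; rewrite /= xsec.
rewrite (product_measure_unique (m' := (m1 \x^ m2)%E)).
- by apply: eq_integral => t _; rewrite /= ysec.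
- by move=> A B mA mB; exact: product_measure2E.
- exact: measurable_bool_set.
Qed.

Lemma measurable_fun_section1 : measurable_fun setT (fun s => m2 [set t | b (s, t)]).
Proof.
under eq_fun do rewrite -xsec.
by apply: measurable_fun_xsection; exact: measurable_bool_set.
Qed.

End Tonelli.

Section ExponentialCompensator.
Context {R : realType} {d : measure_display} {Omega : measurableType d}.
Variables (P : probability Omega R) (rate : R) (X : {RV P >-> R}).
Hypotheses (rate_gt0 : 0 < rate) (lawX : has_exponential_law rate X).
Notation mu := (@lebesgue_measure R).

Let RV_set (A : set R) : measurable A -> measurable (X @^-1` A).
Proof. by move=> mA; rewrite -[X in measurable X]setTI; exact: measurable_funP. Qed.

Let measurable_density :
  measurable_fun setT (fun y => (expR (- rate * y))%:E : \bar R).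
Proof.
by apply/measurable_EFinP; apply: measurableT_comp.
Qed.

Let measurable_pdf :
  measurable_fun setT (fun y => (rate * expR (- rate * y))%:E : \bar R).
Proof.
apply/measurable_EFinP; apply: measurable_funM => //.
by apply/measurable_EFinP.
Qed.

Let law_setI (A : set R) : measurable A ->
  P (X @^-1` A) = (\int[mu]_(y in A `&` `[0%R, +oo[) (rate * expR (- rate * y))%:E)%E.
Proof.
move=> mA; rewrite -[LHS]/(distribution P X A) lawX// /exponential_prob.
rewrite integral_mkcondr; apply: eq_integral => y _.
by rewrite /exponential_pdf !patchE; case: ifP.
Qed.

Lemma exponential_gt z : 0 < z -> P [set w | z < X w] = (expR (- rate * z))%:E.
Proof.
move=> z0.
have -> : [set w | z < X w] = ~` (X @^-1` `]-oo, z]).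
  rewrite eqEsubset; split => w /=; rewrite in_itv/=.
    by move=> h /(lt_le_trans h); rewrite ltxx.
  by move=> /negP; rewrite -ltNge.
rewrite probability_setC; last exact: RV_set.
have -> : P (X @^-1` `]-oo, z]) = P (X @^-1` `[0, z]).
  rewrite !law_setI//; congr integral.
  rewrite eqEsubset; split => y /=; rewrite !in_itv/= !andbT => -[].
    by move=> -> ->.
  by move=> /andP[_ ->] ->.
rewrite -[P (X @^-1` _)]/(distribution P X _) lawX//.
rewrite exponential_prob_itv0c// -EFinB; congr EFin; lra.
Qed.

Lemma exponential_le0 : P [set w | X w <= 0] = 0.
Proof.
have -> : [set w | X w <= 0] = X @^-1` `]-oo, 0].
  by rewrite eqEsubset; split => w /=; rewrite in_itv.
rewrite law_setI// (_ : _ `&` _ = [set 0]) ?integral_set1//.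
rewrite eqEsubset; split => y /=; rewrite !in_itv/= ?andbT.
  by move=> [h1 h2]; apply/le_anti/andP.
by move=> ->.
Qed.

(** A point [z] has been passed by [X] with probability [expR (- rate * z)], so
    that both sides integrate the exponential density over [C]. *)
Lemma exponential_compensator (C : set R) : measurable C ->
  P (X @^-1` C) = (rate%:E * \int[P]_w mu (`]0%R, X w[ `&` C))%E.
Proof.
move=> mC.
have mb : measurable_fun setT (fun z : Omega * R =>
    [&& 0 < z.2, z.2 < X z.1 & z.2 \in C]).
  apply: measurable_and; first exact: measurable_fun_ltr.
  apply: measurable_and.
    by apply: measurable_fun_ltr => //; exact: measurableT_comp.
  by apply: measurableT_comp => //; exact: measurable_fun_in.
have -> : (\int[P]_w mu (`]0%R, X w[ `&` C) =
    \int[mu]_(z in `]0%R, +oo[ `&` C) (expR (- rate * z))%:E)%E.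
  transitivity (\int[P]_w mu [set z | [&& 0 < z, z < X w & z \in C]%R])%E.
    apply: eq_integral => w _; congr (mu _).
    rewrite eqEsubset; split => z /=; rewrite in_itv/=.
      by move=> [/andP[-> ->]] /mem_set ->.
    by move=> /and3P[-> -> /set_mem].
  rewrite (tonelli_bool P mu mb).
  rewrite [RHS]integral_mkcond; apply: eq_integral => z _ /=.
  rewrite patchE; case: ifPn => [/set_mem/=[]|/negP zC].
    rewrite in_itv/= andbT => z0 /mem_set ->.
    by rewrite -exponential_gt//; congr (P _); apply/funext => w /=; rewrite z0 andbT.
  rewrite [X in P X](_ : _ = set0) ?measure0// -subset0 => w /= /and3P[z0 _ /set_mem zC'].
  by apply: zC; apply/mem_set; split => //=; rewrite in_itv/= z0.
rewrite law_setI// -ge0_integralZl_EFin//; last first.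
- exact: ltW.
- exact: measurable_funTS.
- exact: measurableI.
rewrite -(integral_setD1 (r := 0) (D := C `&` _)); last 2 first.
- by apply: measurableD => //; exact: measurableI.
- exact: measurable_funTS.
congr integral; rewrite eqEsubset; split => y /=; rewrite !in_itv/= !andbT.
  by move=> [[Cy y0] /eqP yn0]; rewrite lt_neqAle eq_sym yn0.
by move=> [y0 Cy]; rewrite (ltW y0); split=> //; apply/eqP; rewrite gt_eqF.
Qed.

End ExponentialCompensator.

Section Compensator.
Context {R : realType} {I : eqType}.

Definition update (v : I -> R) (j : I) (z : R) : I -> R :=
  fun i => if i == j then z else v i.

Lemma update_id v j : update v j (v j) = v.
Proof. by apply/funext => i; rewrite /update; case: eqP => [->|]. Qed.

Lemma update_same v j z : update v j z j = z.
Proof. by rewrite /update eqxx. Qed.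

Lemma update_other v i j z : i != j -> update v j z i = v i.
Proof. by rewrite /update => /negbTE ->. Qed.

(** Measurability of a function of a configuration, said without a
    sigma-algebra on the configurations: it is this form that can be used at a
    configuration some of whose coordinates are frozen. *)
Definition measurable_functional d (S : measurableType d) (phi : (I -> R) -> S) :=
  forall d' (T : measurableType d') (X : I -> T -> R),
    (forall i, measurable_fun setT (X i)) ->
    measurable_fun setT (fun t => phi (X^~ t)).

Context {d : measure_display} {Omega : measurableType d}.
Variables (P : probability Omega R) (x : I -> {RV P >-> R}).
Hypothesis indep : mutually_independent x.
Variables (j : I) (rate : R).
Hypotheses (rate_gt0 : 0 < rate) (lawj : has_exponential_law rate (x j)).
Notation mu := (@lebesgue_measure R).
Notation others := (g_sigma_algebraType (cylinders x j)).

(** The same identity for an event that depends on all the variables: the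
    others are frozen by Fubini while [x j] is compared with the values [z]
    that it has passed. *)
Lemma compensator (phi : (I -> R) -> bool) : measurable_functional phi ->
  P [set w | phi (x^~ w)] =
  (rate%:E * \int[P]_w
     mu [set z | [&& (0 < z)%R, (z < x j w)%R & phi (update (x^~ w) j z)]])%E.
Proof.
move=> mphi.
pose F (y : R * others) : bool := phi (update (x^~ y.2) j y.1).
have mF : measurable_fun setT F.
  rewrite /F.
  have -> : (fun y : R * others => phi (update (x^~ y.2) j y.1)) =
     (fun y : R * others =>
        phi ((fun i (y : R * others) => if i == j then y.1 else x i y.2)^~ y)) by [].
  apply: mphi => i; case: eqP => [_|/eqP ij]; first exact: measurable_fst.
  have msnd : measurable_fun setT (snd : R * others -> others).
    exact: measurable_snd.
  have mxi : measurable_fun setT (x i : others -> R).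
    exact: measurable_coordinate_others ij.
  exact: (measurableT_comp mxi msnd).
pose G (y : R * others) := mu [set z | [&& 0 < z, z < y.1 & F (z, y.2)]].
have mG : measurable_fun setT G.
  have mF3 : measurable_fun setT (fun u : (R * others) * R => F (u.2, u.1.2)).
    apply: (measurableT_comp mF); apply: measurable_fun_pair.
      exact: measurable_snd.
    exact: (measurableT_comp measurable_snd measurable_fst).
  have m1 : measurable_fun setT (fun u : (R * others) * R => u.2 < u.1.1).
    by apply: measurable_fun_ltr => //; exact: measurableT_comp.
  have m0 : measurable_fun setT (fun u : (R * others) * R => 0 < u.2).
    exact: measurable_fun_ltr.
  exact: (measurable_fun_section1 mu
    (measurable_and m0 (measurable_and m1 mF3))).
have mFw w : measurable_fun setT (fun y => F (y, w)).
  by apply: (measurableT_comp mF); exact: pair2_measurable.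
have mind : measurable_fun setT (EFin \o \1_[set y | F y] : R * others -> \bar R).
  by apply/measurable_EFinP; apply: measurable_indic; exact: measurable_bool_set.
transitivity (\int[P]_w ((EFin \o \1_[set y | F y]) (x j w, w)))%E.
  rewrite -[in LHS](setIT [set w | _]) -integral_indic//.
    apply: eq_integral => w _ /=; congr EFin; rewrite !indicE; congr (_%:R).
    by congr nat_of_bool; apply/idP/idP => /set_mem h; apply/mem_set; move: h;
      rewrite /F/= update_id.
  by apply: measurable_bool_set; apply: mphi => i.
rewrite (ge0_integral_isolate indep)//; last by move=> z /=; rewrite lee_fin.
have G0 y : (0 <= G y)%E by [].
have mrG : measurable_fun setT (fun y => rate%:E * G y)%E.
  exact: measurable_funeM.
have mxjw w' : measurable_fun setT (fun w => (x j w, w') : R * others).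
  by apply: measurable_fun_pair.
transitivity (\int[P]_w' \int[P]_w (rate%:E * G (x j w, w')))%E.
  apply: eq_integral => w' _.
  transitivity (P (x j @^-1` [set y | F (y, w')])).
    rewrite -[in RHS](setIT (_ @^-1` _)) -integral_indic//.
    rewrite -[X in measurable X]setTI; apply: measurable_funP => //.
    exact: measurable_bool_set.
  rewrite (exponential_compensator rate_gt0 lawj); last exact: measurable_bool_set.
  rewrite ge0_integralZl_EFin//; last 2 first.
  - exact: (measurableT_comp mG (mxjw w')).
  - exact: ltW.
  congr (_ * _)%E; apply: eq_integral => w _; congr (mu _).
  rewrite eqEsubset; split => z /=; rewrite in_itv/=.
    by move=> [/andP[-> ->]].
  by move=> /and3P[-> ->].
rewrite -(ge0_integral_isolate indep (F := fun y => rate%:E * G y)%E)//; last first.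
  by move=> z; rewrite mule_ge0// lee_fin ltW.
rewrite ge0_integralZl_EFin//; last exact: ltW.
have mself : measurable_fun setT (fun w => (x j w, w) : R * others).
  by apply: measurable_fun_pair => //; exact: measurable_others.
exact: (measurableT_comp mG mself).
Qed.

End Compensator.

(** * Trajectories *)

Section RemovalTime.
Context {R : realType}.
Variables (tau : R) (pi : policy R).
Implicit Types (e : nat -> R) (a r s : R).

Lemma removal_time_le e a (y2 y1 : R) :
  removal_time tau pi e a y2 y1 <= a + y2 + y1.
Proof.
apply: ge_inf; last by left.
exists (Num.min a (a + y2 + y1)) => s [/= ->|[/andP[/ltW as_ _] _]].
  by rewrite ge_min lexx orbT.
by rewrite ge_min as_.
Qed.

Lemma removal_time_ge e a (y2 y1 r : R) : r <= a + y2 + y1 ->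
  r <= removal_time tau pi e a y2 y1 <->
  forall s, a < s < r -> ~ replace_at tau pi e (condition_at a y2 s) s.
Proof.
move=> rF; split => [rS s /andP[as_ sr] repl|norepl].
  have : removal_time tau pi e a y2 y1 <= s.
    apply: ge_inf; last first.
      by right; split => //; rewrite as_ (lt_le_trans sr).
    exists (Num.min a (a + y2 + y1)) => t [/= ->|[/andP[/ltW at_ _] _]].
      by rewrite ge_min lexx orbT.
    by rewrite ge_min at_.
  by move=> /(le_trans rS); rewrite leNgt sr.
apply: lb_le_inf; first by exists (a + y2 + y1); left.
move=> s [/= -> //|[/andP[as_ _] repl]]; rewrite leNgt; apply/negP => sr.
by apply: (norepl s) => //; rewrite as_ sr.
Qed.

Lemma seq_has_least (s : seq R) (A : set R) : A `<=` [set` s] -> A !=set0 ->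
  exists2 x, A x & forall y, A y -> x <= y.
Proof.
elim: s A => [A sA [x /sA]//|z s IH A sA A0].
have [[x [Ax xz]]|h] := pselect (exists x, A x /\ x <> z); last first.
  have Az x : A x -> x = z.
    by move=> Ax; apply: contrapT => xz; apply: h; exists x.
  case: A0 => x Ax; exists x => // y Ay.
  by rewrite (Az _ Ax) (Az _ Ay).
have [||m [Am mz] mmin] := IH (A `\ z).
- by move=> y [/sA /=]; rewrite inE => /orP[/eqP ->|].
- by exists x.
have [Az|nAz] := pselect (A z); last first.
  exists m => // y Ay; apply: mmin; split => //= yz; apply: nAz.
  by rewrite -yz.
exists (Num.min m z); first by rewrite minElt; case: ifP.
move=> y Ay; have [->|/eqP yz] := eqVneq y z; first by rewrite ge_min lexx orbT.
by rewrite ge_min mmin.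
Qed.

(** The infimum in [removal_time] is a minimum when only finitely many
    opportunities precede the failure. *)
Lemma removal_time_attained e a (y2 y1 : R) : 0 < tau ->
  (exists n, forall m, (n <= m)%N -> a + y2 + y1 < \sum_(i < m.+1) e i) ->
  removal_time tau pi e a y2 y1 < a + y2 + y1 ->
  a < removal_time tau pi e a y2 y1 /\
  replace_at tau pi e (condition_at a y2 (removal_time tau pi e a y2 y1))
    (removal_time tau pi e a y2 y1).
Proof.
move=> tau_gt0 [N eN] lt_rem.
set F := a + y2 + y1 in lt_rem *.
pose A := [set s | a < s < F /\ replace_at tau pi e (condition_at a y2 s) s].
have [M FM] : exists M : nat, F / tau < M%:R.
  exists (Num.truncn (`|F / tau|)).+1.
  by rewrite (le_lt_trans (ler_norm _))// truncnS_gt.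
have sA : A `<=` [set` [seq \sum_(i < n.+1) e i | n <- iota 0 N] ++
                       [seq m.+1%:R * tau | m <- iota 0 M]].
  move=> s [/andP[_ sF]] [[[m sE] _]|[[n sE] _]] /=; rewrite mem_cat; apply/orP.
    right; apply/mapP; exists m => //; rewrite mem_iota/= add0n.
    have : m.+1%:R < M%:R :> R.
      by rewrite (le_lt_trans _ FM)// ler_pdivlMr// -sE ltW.
    by rewrite ltr_nat => /ltnW.
  left; apply/mapP; exists n => //; rewrite mem_iota/= add0n ltnNge.
  by apply/negP => /eN; rewrite -sE => /(lt_trans sF); rewrite ltxx.
have [x Ax xmin] : exists2 x, A x & forall y, A y -> x <= y.
  apply: (seq_has_least sA); apply: contrapT => nA.
  suff : F <= removal_time tau pi e a y2 y1 by rewrite leNgt lt_rem.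
  apply/removal_time_ge => // s asF repl; apply: nA; by exists s.
suff -> : removal_time tau pi e a y2 y1 = x.
  by case: Ax => /andP[].
apply/le_anti/andP; split.
  apply: ge_inf; last by right.
  exists (Num.min a F) => t [/= ->|[/andP[/ltW at_ _] _]].
    by rewrite ge_min lexx orbT.
  by rewrite ge_min at_.
case: (Ax) => /andP[_ xF] _.
apply/removal_time_ge => //; first exact: ltW.
move=> s /andP[as_ sx] repl; have : x <= s.
  by apply: xmin; split => //; rewrite as_ (lt_trans sx).
by rewrite leNgt sx.
Qed.

Lemma install_time_ext x2 x1 x2' x1' e k :
  (forall l, (l < k)%N -> x2 l = x2' l /\ x1 l = x1' l) ->
  install_time tau pi x2 x1 e k = install_time tau pi x2' x1' e k.
Proof.
elim: k => //= k IH h; rewrite IH; last by move=> l lk; apply: h; exact: ltnW.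
by have [-> ->] := h k (ltnSn k).
Qed.

End RemovalTime.

(** One index for all the durations of the model: the two sojourn times of each
    component and the gaps between unscheduled opportunities. *)
Notation clock := (nat + nat + nat)%type.

Section Configuration.
Context {R : realType}.
Variables (tau : R) (pi : policy R).
Implicit Types (v : clock -> R) (k n : nat).

Definition sojourn2 v k := v (inl (inl k)).
Definition sojourn1 v k := v (inl (inr k)).
Definition gap v n := v (inr n).

Definition inst v k := install_time tau pi (sojourn2 v) (sojourn1 v) (gap v) k.
Arguments inst : simpl never.
Definition wear v k := inst v k + sojourn2 v k.
Definition fail v k := wear v k + sojourn1 v k.
Definition uso v n := \sum_(i < n) gap v i.

Definition is_perfect (i : condition) : bool := if i is Perfect then true else false.

(** What the decision maker would see at an opportunity at time [u]. The
    component to be replaced is the one in use just before [u], whence the two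
    comparisons with [inst]; an opportunity at the very time of a failure comes
    too late, whence the comparison with [fail]. *)
Definition observed v k i (u : R) : bool :=
  [&& inst v k < u, u < fail v k, u <= inst v k.+1 &
      (u < wear v k) == is_perfect i].

Definition failed v k : bool := inst v k.+1 == fail v k.

Definition removed v k i : bool :=
  (inst v k.+1 < fail v k) && ((inst v k.+1 < wear v k) == is_perfect i).

Lemma condition_atE v k i u :
  ((u < wear v k) == is_perfect i) = true ->
  condition_at (inst v k) (sojourn2 v k) u = i.
Proof. by rewrite /condition_at -/(wear v k); case: ifP; case: i. Qed.

Lemma condition_at_perfect v k u :
  ((u < wear v k) == is_perfect (condition_at (inst v k) (sojourn2 v k) u)).
Proof. by rewrite /condition_at -/(wear v k); case: ifP. Qed.

Lemma inst_le_fail v k : inst v k.+1 <= fail v k.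
Proof. exact: removal_time_le. Qed.

Lemma inst_ge v k r : r <= fail v k ->
  r <= inst v k.+1 <->
  forall s, inst v k < s < r ->
    ~ replace_at tau pi (gap v) (condition_at (inst v k) (sojourn2 v k) s) s.
Proof. by move=> rF; exact: removal_time_ge. Qed.

Lemma inst_update_sojourn2 v k z : inst (update v (inl (inl k)) z) k = inst v k.
Proof.
apply: install_time_ext => l lk; split; rewrite /sojourn2 /sojourn1 update_other//;
  by apply/eqP => -[lkE]; rewrite lkE ltnn in lk.
Qed.

Lemma inst_update_sojourn1 v k z : inst (update v (inl (inr k)) z) k = inst v k.
Proof.
apply: install_time_ext => l lk; split; rewrite /sojourn2 /sojourn1 update_other//;
  by apply/eqP => -[lkE]; rewrite lkE ltnn in lk.
Qed.

Lemma wear_update_sojourn2 v k z :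
  wear (update v (inl (inl k)) z) k = inst v k + z.
Proof. by rewrite /wear inst_update_sojourn2 /sojourn2 update_same. Qed.

Lemma wear_update_sojourn1 v k z :
  wear (update v (inl (inr k)) z) k = wear v k.
Proof. by rewrite /wear inst_update_sojourn1 /sojourn2 update_other. Qed.

Lemma fail_update_sojourn1 v k z :
  fail (update v (inl (inr k)) z) k = wear v k + z.
Proof. by rewrite /fail wear_update_sojourn1 /sojourn1 update_same. Qed.

Section Positive.
Variable v : clock -> R.
Hypothesis v_gt0 : forall c, 0 < v c.

Lemma inst_lt_wear k : inst v k < wear v k.
Proof. by rewrite ltrDl v_gt0. Qed.

Lemma wear_lt_fail k : wear v k < fail v k.
Proof. by rewrite ltrDl v_gt0. Qed.

Lemma inst_lt_fail k : inst v k < fail v k.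
Proof. exact: lt_trans (inst_lt_wear k) (wear_lt_fail k). Qed.

Lemma inst_leS k : inst v k <= inst v k.+1.
Proof.
apply/inst_ge; first exact/ltW/inst_lt_fail.
by move=> s /andP[/lt_trans h /h]; rewrite ltxx.
Qed.

Lemma inst_le : {homo inst v : k l / (k <= l)%N >-> k <= l}.
Proof. by apply: homo_leq => //; [exact: le_trans|exact: inst_leS]. Qed.

Lemma inst_ge0 k : 0 <= inst v k.
Proof. exact: (@inst_le 0%N). Qed.

Lemma uso_ltS n : uso v n < uso v n.+1.
Proof. by rewrite /uso big_ord_recr/= ltrDl v_gt0. Qed.

Lemma uso_lt : {mono uso v : n m / (n < m)%N >-> n < m}.
Proof.
have lt_uso : {homo uso v : n m / (n < m)%N >-> n < m}.
  by apply: homo_ltn => [? ? ?|]; [exact: lt_trans|exact: uso_ltS].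
move=> n m; apply/idP/idP; last exact: lt_uso.
have [//|/lt_uso mn nm|->] := ltngtP n m; last by rewrite ltxx.
by have := lt_trans mn nm; rewrite ltxx.
Qed.

Lemma uso_ge0 n : 0 <= uso v n.
Proof. by apply: sumr_ge0 => i _; exact/ltW/v_gt0. Qed.

(** Had component [k] worn at the earlier age [z], it would have reached that
    age exactly when it does in the actual trajectory: what happens before does
    not depend on the rest of the sojourn time. *)
Lemma observed_wear k z : 0 < z -> z < sojourn2 v k ->
  (inst v k + z <= inst (update v (inl (inl k)) z) k.+1) =
  observed v k Perfect (inst v k + z).
Proof.
move=> z0 zy.
set v' := update _ _ _.
have instE : inst v' k = inst v k by exact: inst_update_sojourn2.
have zw : inst v k + z < wear v k by rewrite ltrD2l.
rewrite /observed ltrDl z0 (lt_trans zw (wear_lt_fail k)) zw eqxx andbT/=.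
have zF' : inst v k + z <= fail v' k.
  by rewrite /fail wear_update_sojourn2 /sojourn1 /v' update_other// lerDl ltW.
have zF : inst v k + z <= fail v k := ltW (lt_trans zw (wear_lt_fail k)).
apply/idP/idP => /inst_ge h; apply/inst_ge => // s /andP[ls su].
  have := h zF' s; rewrite instE ls su => /(_ isT).
  rewrite /condition_at /sojourn2 /v' update_same su -/(wear v k) (lt_trans su zw).
  exact.
have := h zF s; rewrite instE in ls *; rewrite ls su => /(_ isT).
by rewrite /condition_at /sojourn2 /v' update_same su -/(wear v k) (lt_trans su zw).
Qed.

(** The same for the age at failure. *)
Lemma observed_fail k z : 0 < z -> z < sojourn1 v k ->
  (inst (update v (inl (inr k)) z) k.+1 == wear v k + z) =
  observed v k Satisfactory (wear v k + z).
Proof.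
move=> z0 zy.
set v' := update _ _ _.
have instE : inst v' k = inst v k by exact: inst_update_sojourn1.
have zf : wear v k + z < fail v k by rewrite ltrD2l.
have failE : fail v' k = wear v k + z by exact: fail_update_sojourn1.
have nw : (wear v k + z < wear v k) = false by rewrite ltNge lerDl ltW.
have Sw : inst v k < wear v k + z.
  by rewrite (lt_le_trans (inst_lt_wear k))// lerDl ltW.
rewrite /observed zf Sw nw eqxx andbT /=.
rewrite eq_le -{1}failE inst_le_fail/=.
have zF' : wear v k + z <= fail v' k by rewrite failE.
apply/idP/idP => /inst_ge h; apply/inst_ge => //.
- exact: ltW.
- move=> s /andP[ls su]; have := h zF' s; rewrite instE ls su => /(_ isT).
  by rewrite /condition_at /sojourn2 /v' update_other.
- move=> s /andP[ls su]; have := h (ltW zf) s; rewrite instE in ls *.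
  rewrite ls su => /(_ isT).
  by rewrite /condition_at /sojourn2 /v' update_other.
Qed.

End Positive.

(** The trajectory up to time [u] does not depend on the opportunities that
    come at [u] or later. *)
Lemma inst_causal v v' u :
  (forall c, 0 < v c) -> (forall c, 0 < v' c) ->
  (forall k, sojourn2 v k = sojourn2 v' k /\ sojourn1 v k = sojourn1 v' k) ->
  (forall s, s < u -> is_uso (gap v) s <-> is_uso (gap v') s) ->
  forall k r, r <= u -> (r <= inst v k) = (r <= inst v' k).
Proof.
move=> v0 v'0 vv' uso_eq; elim=> [//|k IH] r ru.
have [uS|Su] := leP u (inst v k).
  have uS' : u <= inst v' k by rewrite -IH.
  by rewrite (le_trans ru (le_trans uS (inst_leS v0 k)))
    (le_trans ru (le_trans uS' (inst_leS v'0 k))).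
have S'u : inst v' k < u by rewrite ltNge -IH// -ltNge.
have SE : inst v k = inst v' k.
  by apply/le_anti; rewrite -IH ?(ltW Su)// lexx IH ?(ltW S'u)// lexx.
have [s2E s1E] := vv' k.
have wE : wear v k = wear v' k by rewrite /wear SE s2E.
have fE : fail v k = fail v' k by rewrite /fail wE s1E.
have [rF|Fr] := leP r (fail v k); last first.
  rewrite leNgt (le_lt_trans (inst_le_fail v k) Fr)/=.
  by rewrite leNgt (le_lt_trans (inst_le_fail v' k))// -fE.
have replE i s : s < r ->
    replace_at tau pi (gap v) i s <-> replace_at tau pi (gap v') i s.
  by move=> sr; rewrite /replace_at uso_eq// (lt_le_trans sr).
apply/idP/idP => /inst_ge h; apply/inst_ge; rewrite ?fE// -?fE// => s /andP[ls sr].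
  have := h rF s; rewrite SE s2E ls sr => /(_ isT).
  by rewrite replE.
have := h _ s; rewrite -fE -SE -s2E in ls *; rewrite ls sr => /(_ rF isT).
by rewrite replE.
Qed.

Lemma observed_causal v v' u :
  (forall c, 0 < v c) -> (forall c, 0 < v' c) ->
  (forall k, sojourn2 v k = sojourn2 v' k /\ sojourn1 v k = sojourn1 v' k) ->
  (forall s, s < u -> is_uso (gap v) s <-> is_uso (gap v') s) ->
  forall k i, observed v k i u = observed v' k i u.
Proof.
move=> v0 v'0 vv' uso_eq k i.
have IH := inst_causal v0 v'0 vv' uso_eq.
rewrite /observed [inst v k < u]ltNge [inst v' k < u]ltNge -!IH//.
have [//|Su] := leP u (inst v k).
have S'u : inst v' k < u by rewrite ltNge -IH// -ltNge.
have SE : inst v k = inst v' k.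
  by apply/le_anti; rewrite -IH ?(ltW Su)// lexx IH ?(ltW S'u)// lexx.
have [s2E s1E] := vv' k.
have wE : wear v k = wear v' k by rewrite /wear SE s2E.
by rewrite {1}/fail {1}/fail wE s1E.
Qed.

Lemma uso_update_gap v n z m : (m <= n)%N -> uso (update v (inr n) z) m = uso v m.
Proof.
move=> mn; apply: eq_bigr => i _; rewrite /gap update_other//.
by apply/eqP => -[iE]; have := ltn_ord i; rewrite iE ltnNge mn.
Qed.

Lemma usoS v n : uso v n.+1 = uso v n + gap v n.
Proof. by rewrite /uso big_ord_recr. Qed.

(** Moving an unscheduled opportunity to the earlier time [uso v n + z] leaves
    unchanged what would be observed there. *)
Lemma observed_gap v k i n z : (forall c, 0 < v c) -> 0 < z -> z < gap v n ->
  observed (update v (inr n) z) k i (uso v n + z) = observed v k i (uso v n + z).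
Proof.
move=> v0 z0 zg; apply: observed_causal => //.
  by move=> c; rewrite /update; case: ifP.
have upd0 c : 0 < update v (inr n) z c by rewrite /update; case: ifP.
move=> s su; split=> -[m sE]; exists m; rewrite sE;
  rewrite -/(uso v m.+1) -/(uso (update v (inr n) z) m.+1) ?uso_update_gap//;
  rewrite leqNgt; apply/negP => nm.
- have : uso (update v (inr n) z) n.+1 <= uso (update v (inr n) z) m.+1.
    by rewrite leNgt uso_lt// -leqNgt.
  rewrite -[uso _ m.+1]sE usoS uso_update_gap// /gap update_same.
  move=> /(lt_le_trans su).
  by rewrite ltxx.
- have : uso v n.+1 <= uso v m.+1 by rewrite leNgt uso_lt// -leqNgt.
  rewrite usoS -[uso v m.+1]sE => h.
  by have := le_lt_trans h su; rewrite ltrD2l ltNge (ltW zg).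
Qed.

(** ** Trajectories whose clocks do not accumulate *)

Section Regular.
Variable v : clock -> R.
Hypotheses (tau_gt0 : 0 < tau) (v_gt0 : forall c, 0 < v c).
Hypothesis uso_unbounded : forall T : R, exists n, T < uso v n.
Hypothesis sojourn2_unbounded : forall T : R, exists n, T < \sum_(k < n) sojourn2 v k.

Lemma removal_opportunity k : inst v k.+1 < fail v k ->
  inst v k < inst v k.+1 /\
  replace_at tau pi (gap v)
    (condition_at (inst v k) (sojourn2 v k) (inst v k.+1)) (inst v k.+1).
Proof.
move=> lt_fail; apply: removal_time_attained => //.
have [n Fn] := uso_unbounded (fail v k); exists n => m nm.
apply: (lt_trans Fn); rewrite -/(uso v m.+1) uso_lt//.
Qed.

Lemma inst_ltS k : inst v k < inst v k.+1.
Proof.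
have [/removal_opportunity[]//|] := ltP (inst v k.+1) (fail v k).
exact/lt_le_trans/inst_lt_fail.
Qed.

Lemma inst_inj : injective (inst v).
Proof.
have lt_inst : {homo inst v : k l / (k < l)%N >-> k < l}.
  by apply: homo_ltn => [? ? ?|]; [exact: lt_trans|exact: inst_ltS].
by move=> k l; have [/lt_inst|/lt_inst|//] := ltngtP k l => /[swap] ->;
  rewrite ltxx.
Qed.

(** Installation times are distinct, and up to time [T] only finitely many of
    them are opportunities. All later components would then run to failure,
    which takes an unbounded total time. *)
Lemma inst_unbounded T : exists k, T < inst v k.
Proof.
apply: contrapT => /forallNP nT.
have instT k : inst v k <= T by rewrite leNgt; apply/negP; exact: nT.
have eventually_not (s : nat -> R) N :
    exists K, forall k n, (K <= k)%N -> (n < N)%N -> inst v k.+1 <> s n.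
  elim: N => [|N [K IH]]; first by exists 0%N.
  have [[k0 k0E]|h] := pselect (exists k0, inst v k0.+1 = s N); last first.
    exists K => k n Kk; rewrite ltnS leq_eqVlt => /orP[/eqP -> kE|nN].
      by apply: h; exists k.
    exact: IH.
  exists (maxn K k0.+1) => k n; rewrite geq_max => /andP[Kk k0k].
  rewrite ltnS leq_eqVlt => /orP[/eqP ->|nN]; last exact: IH.
  by rewrite -k0E => /inst_inj[kE]; rewrite kE ltnn in k0k.
have [N NT] := uso_unbounded T.
have [M MT] : exists M : nat, T / tau < M%:R.
  exists (Num.truncn (`|T / tau|)).+1.
  by rewrite (le_lt_trans (ler_norm _))// truncnS_gt.
have [K1 K1P] := eventually_not (uso v) N.
have [K2 K2P] := eventually_not (fun m => m%:R * tau) M.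
pose K := maxn K1 K2.
have allfail k : (K <= k)%N -> inst v k.+1 = fail v k.
  rewrite geq_max => /andP[K1k K2k].
  apply/le_anti; rewrite inst_le_fail/= leNgt; apply/negP => /removal_opportunity.
  move=> [_ [[[m mE] _]|[[n nE] _]]].
    apply: (K2P k m.+1) => //.
    by rewrite -(ltr_nat R) (le_lt_trans _ MT)// ler_pdivlMr// -mE.
  apply: (K1P k n.+1) => //.
  rewrite ltnNge; apply/negP => Nn.
  have := instT k.+1; rewrite nE -/(uso v n.+1) leNgt => /negP; apply.
  by rewrite (lt_le_trans NT)// leNgt uso_lt// -leqNgt.
have lower n : \sum_(K <= k < K + n) sojourn2 v k <= inst v (K + n).
  elim: n => [|n IHn]; first by rewrite addn0 big_geq// inst_ge0.
  rewrite addnS big_nat_recr/= ?leq_addr// allfail ?leq_addr//.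
  by rewrite /fail /wear -addrA lerD// lerDl; exact/ltW/v_gt0.
have [n] := sojourn2_unbounded (\sum_(k < K) sojourn2 v k + T).
have [nK|Kn] := leqP n K.
  rewrite ltNge => /negP; apply.
  have T0 : 0 <= T by exact: le_trans (inst_ge0 v_gt0 0) (instT 0%N).
  rewrite ler_wpDr//.
  rewrite -!(big_mkord xpredT (sojourn2 v)) (big_cat_nat (leq0n n) nK)//= lerDl.
  by apply: sumr_ge0 => ? _; exact/ltW/v_gt0.
rewrite -!(big_mkord xpredT (sojourn2 v)) (big_cat_nat (leq0n K) (ltnW Kn))//= ltrD2l.
rewrite -(subnKC (ltnW Kn)) ltNge => /negP; apply.
exact: le_trans (lower _) (instT _).
Qed.

Lemma observed_exists u : 0 < u -> (forall k, u <> fail v k) ->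
  exists k i, observed v k i u.
Proof.
move=> u0 uF.
have ex : exists k, u <= inst v k by have [k /ltW] := inst_unbounded u; exists k.
have [[|k] uk kmin] := ex_minnP ex; first by rewrite leNgt u0 in uk.
exists k, (condition_at (inst v k) (sojourn2 v k) u).
rewrite /observed uk condition_at_perfect/= andbT.
apply/andP; split.
  by rewrite ltNge; apply/negP => /kmin; rewrite ltnn.
rewrite lt_neqAle (le_trans uk (inst_le_fail _ _)) andbT.
by apply/eqP; exact: uF.
Qed.

End Regular.

Lemma observed_unique v u k k' i i' : (forall c, 0 < v c) ->
  observed v k i u -> observed v k' i' u -> k = k' /\ i = i'.
Proof.
move=> v0 /and4P[Sk _ kS iE] /and4P[Sk' _ kS' iE'].
have kk' : k = k'.
  have [h|h|//] := ltngtP k k'.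
    by have := lt_le_trans Sk' (le_trans kS (inst_le v0 h)); rewrite ltxx.
  by have := lt_le_trans Sk (le_trans kS' (inst_le v0 h)); rewrite ltxx.
split => //; rewrite -kk' (eqP iE) in iE'.
by move: iE'; case: i {iE}; case: i'.
Qed.

End Configuration.
Arguments inst {R} tau pi v k : simpl never.

Lemma or3_of_sum (a b c e : bool) :
  (a : nat) = (b + c + e)%N -> (a : Prop) = ((b \/ c) \/ e).
Proof. by move=> h; apply/propext; move: a b c e h => [] [] [] [] //= _; intuition. Qed.

(** ** Replacements at opportunities *)

Section Opportunity.
Context {R : realType}.
Variables (tau : R) (pi : policy R).
Hypothesis tau_gt0 : 0 < tau.
Implicit Types (v : clock -> R) (i : condition).

Definition replaces i j t : bool := if pi i j t is Replace then true else false.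
Definition hit i (u : R) : bool := replaces i USO (remaining tau u).

Lemma replacesP i j t : reflect (pi i j t = Replace) (replaces i j t).
Proof. by rewrite /replaces; case: (pi i j t); constructor. Qed.

Lemma remaining_itv u : 0 <= remaining tau u < tau.
Proof.
rewrite /remaining subr_ge0 -ler_pdivrMr// ceil_ge/=.
have := ceilB1_lt (u / tau); rewrite ltr_pdivlMr// intrB mulrBl mul1r.
by rewrite ltrBlDr ltrBlDl.
Qed.

Lemma remainingD u : remaining tau (u + tau) = remaining tau u.
Proof.
rewrite /remaining mulrDl divff ?gt_eqF// ceilDrz ?rpred1//.
by rewrite ceil1 intrD mulrDl mul1r opprD addrACA subrr addr0.
Qed.

Lemma hitD i u : hit i (u + tau) = hit i u.
Proof. by rewrite /hit remainingD. Qed.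

Lemma replace_atP v i u :
  replace_at tau pi (gap v) i u <->
  (exists m : nat, u = m.+1%:R * tau) /\ replaces i SO 0 \/
  (exists n, u = uso v n.+1) /\ hit i u.
Proof.
split=> -[[h /replacesP h']|[h /replacesP h']]; by [left|right].
Qed.

Lemma removedP v k i : (forall c, 0 < v c) ->
  (forall T : R, exists n, T < uso v n) -> removed tau pi v k i ->
  observed tau pi v k i (inst tau pi v k.+1) /\
  ((exists m : nat, inst tau pi v k.+1 = m.+1%:R * tau) /\ replaces i SO 0 \/
   (exists n, inst tau pi v k.+1 = uso v n.+1) /\ hit i (inst tau pi v k.+1)).
Proof.
move=> v0 unb /andP[lf iE].
have [lS repl] := removal_opportunity tau_gt0 v0 unb lf.
split; first by rewrite /observed lS lf lexx iE.
by apply/replace_atP; rewrite -(condition_atE iE).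
Qed.

Lemma observed_replace v k i u : (forall c, 0 < v c) ->
  observed tau pi v k i u -> replace_at tau pi (gap v) i u ->
  inst tau pi v k.+1 = u /\ removed tau pi v k i.
Proof.
move=> v0 /and4P[Su uF uS iE] repl.
suff SE : inst tau pi v k.+1 = u by rewrite /removed SE uF iE.
apply/le_anti; rewrite uS andbT leNgt; apply/negP => uS'.
have [h _] := inst_ge (inst_le_fail tau pi v k).
apply: (h (lexx _) u); first by rewrite Su uS'.
by rewrite (condition_atE iE).
Qed.

(** Even if opportunities were to accumulate, they would not do so at 0. *)
Lemma inst_gt0 v k : (forall c, 0 < v c) -> 0 < inst tau pi v k.+1.
Proof.
move=> v0; pose r := Num.min (fail tau pi v k) (Num.min tau (uso v 1)).
have F0 : 0 < fail tau pi v k.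
  exact: le_lt_trans (inst_ge0 tau pi v0 k) (inst_lt_fail tau pi v0 k).
have r0 : 0 < r.
  by rewrite !lt_min F0 tau_gt0 (le_lt_trans (uso_ge0 v0 0))// uso_ltS.
apply: (lt_le_trans r0); apply/inst_ge; first by rewrite ge_min lexx.
move=> s /andP[_]; rewrite !lt_min => /and3P[_ st su].
move=> /replace_atP[[[m sE] _]|[[n sE] _]].
  by move: st; rewrite sE -[ltRHS]mul1r ltr_pM2r// ltNge ler1n.
by move: su; rewrite sE (uso_lt v0) ltnS.
Qed.

(** A failure at [T] is counted and a replacement at [T] is not, since what is
    observed at [T] precedes the decision taken there. *)
Lemma balance v k T : (forall c, 0 < v c) ->
  ((wear tau pi v k <= inst tau pi v k.+1) && (wear tau pi v k <= T) : nat) =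
  (observed tau pi v k Satisfactory T
   + (failed tau pi v k && (fail tau pi v k <= T)%R)
   + (removed tau pi v k Satisfactory && (inst tau pi v k.+1 < T)%R))%N.
Proof.
move=> v0; rewrite /observed /failed /removed.
have Sw := inst_lt_wear tau pi v0 k; have wF := wear_lt_fail tau pi v0 k.
have SF := inst_le_fail tau pi v k.
set S := inst tau pi v k in Sw *; set S' := inst tau pi v k.+1 in SF *.
set W := wear tau pi v k in Sw wF *; set F := fail tau pi v k in wF SF *.
have -> : (S' < F) = (S' != F) by rewrite lt_neqAle SF andbT.
have [SFE|nSF] := eqVneq S' F.
  rewrite SFE (ltW wF).
  by case: (ltgtP T F) => ?; case: (leP W T) => ?; case: (ltP S T) => ?;
    rewrite //=; exfalso; lra.
have {}SF : S' < F by rewrite lt_neqAle nSF SF.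
case: (leP W S') => ?; case: (leP W T) => ?; case: (ltP S T) => ?;
 case: (ltP T F) => ?; case: (leP T S') => ?; rewrite //=; exfalso; lra.
Qed.

End Opportunity.

(** ** Measurability *)

Section Measurability.
Context {R : realType} (tau : R) (pi : policy R).
Hypotheses (tau_gt0 : 0 < tau) (mpi : measurable_policy tau pi).

Lemma measurable_remaining : measurable_fun setT (remaining tau).
Proof.
apply: measurable_funB => //; apply: measurable_funM => //.
have mceil : measurable_fun setT (fun x : R => (Num.ceil x)%:~R : R).
  by apply: nondecreasing_measurable => // x y xy; rewrite ler_int le_ceil.
have mdiv : measurable_fun setT (fun x : R => x / tau).
  exact: measurable_funM.
exact: (measurableT_comp mceil mdiv).
Qed.

Lemma measurable_hit i : measurable_fun setT (hit tau pi i).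
Proof.
have -> : hit tau pi i = (fun u => u \in remaining tau @^-1`
    [set t | 0 <= t < tau /\ pi i USO t = Replace]).
  apply/funext => u; apply/replacesP/idP => [h|/set_mem[]//].
  by apply/mem_set; split => //; exact: remaining_itv.
apply: measurable_fun_in; rewrite -[X in measurable X]setTI.
exact: measurable_remaining.
Qed.

Section Functional.
Context d (T : measurableType d) (X : clock -> T -> R).
Hypothesis mX : forall c, measurable_fun setT (X c).

Lemma measurable_uso n : measurable_fun setT (fun t => uso (X^~ t) n).
Proof. by apply: measurable_sum => i; exact: mX. Qed.

(** The installation time is an infimum over countably many opportunities, so
    that its being at least [r] is a countable conjunction. *)
Lemma measurable_inst k : measurable_fun setT (fun t => inst tau pi (X^~ t) k).
Proof.
elim: k => [|k IH]; first exact: measurable_cst.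
pose S t := inst tau pi (X^~ t) k; pose W t := wear tau pi (X^~ t) k.
pose F t := fail tau pi (X^~ t) k.
have mW : measurable_fun setT W by apply: measurable_funD => //; exact: mX.
have mF : measurable_fun setT F by apply: measurable_funD => //; exact: mX.
(* [bad U so r t]: the opportunity at [U t] replaces the component before [r] *)
pose bad (U : T -> R) (so : condition -> R -> bool) r t :=
  [&& S t < U t, U t < r & if U t < W t then so Perfect (U t) else so Satisfactory (U t)].
have mbad U so r : measurable_fun setT U -> (forall i, measurable_fun setT (so i)) ->
    measurable_fun setT (bad U so r).
  move=> mU mso; apply: measurable_and; first exact: measurable_fun_ltr.
  apply: measurable_and; first exact: measurable_fun_ltr.
  apply: measurable_fun_ifT; first exact: measurable_fun_ltr.
    exact: measurableT_comp.
  exact: measurableT_comp.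
apply: (measurability (@RGenCInfty.G R)) => [|/= _ [_] [r] -> <-].
  exact: RGenCInfty.measurableE.
rewrite setTI.
rewrite (_ : _ @^-1` _ = [set t | r <= F t] `&`
  ((\bigcap_m ~` [set t | bad (fun=> m.+1%:R * tau) (fun i _ => replaces pi i SO 0) r t])
   `&` (\bigcap_n ~` [set t | bad (fun t => uso (X^~ t) n.+1) (hit tau pi) r t]))).
  apply: measurableI.
    apply: measurable_bool_set; exact: measurable_fun_ler.
  apply: measurableI; apply: bigcapT_measurable => n; apply: measurableC;
    apply: measurable_bool_set; apply: mbad => //.
    exact: measurable_uso.
  by move=> i; exact: measurable_hit.
rewrite eqEsubset; split => t /=; rewrite in_itv/= andbT.
  move=> rS; have rF : r <= F t := le_trans rS (inst_le_fail _ _ _ _).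
  have [h _] := inst_ge rF; have {}h := h rS.
  split=> //; split => n _ /= /and3P[SU Ur repl].
    apply: (h (n.+1%:R * tau)); first by rewrite SU Ur.
    apply/replace_atP; left; split; first by exists n.
    by rewrite /condition_at -/(wear tau pi (X^~ t) k) -/(W t); move: repl; case: ifP.
  apply: (h (uso (X^~ t) n.+1)); first by rewrite SU Ur.
  apply/replace_atP; right; split; first by exists n.
  by rewrite /condition_at -/(wear tau pi (X^~ t) k) -/(W t); move: repl; case: ifP.
move=> [rF [hso huso]]; apply/inst_ge => // s /andP[Ss sr] /replace_atP.
rewrite /condition_at -/(wear tau pi (X^~ t) k) -/(W t).
move=> [[[m sE]]|[[n sE]]] repl.
  apply: (hso m) => //=; rewrite /bad -sE Ss sr/=.
  by move: repl; case: ifP.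
apply: (huso n) => //=; rewrite /bad -sE Ss sr/=.
by move: repl; case: ifP.
Qed.

Lemma measurable_wear k : measurable_fun setT (fun t => wear tau pi (X^~ t) k).
Proof. by apply: measurable_funD; [exact: measurable_inst|exact: mX]. Qed.

Lemma measurable_fail k : measurable_fun setT (fun t => fail tau pi (X^~ t) k).
Proof. by apply: measurable_funD; [exact: measurable_wear|exact: mX]. Qed.

Lemma measurable_observed k i (U : T -> R) : measurable_fun setT U ->
  measurable_fun setT (fun t => observed tau pi (X^~ t) k i (U t)).
Proof.
move=> mU; apply: measurable_and.
  by apply: measurable_fun_ltr => //; exact: measurable_inst.
apply: measurable_and.
  by apply: measurable_fun_ltr => //; exact: measurable_fail.
apply: measurable_and.
  by apply: measurable_fun_ler => //; exact: measurable_inst.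
have mUW : measurable_fun setT (fun t => U t < wear tau pi (X^~ t) k).
  by apply: measurable_fun_ltr => //; exact: measurable_wear.
case: i => /=; first by under eq_fun do rewrite eqb_id.
by under eq_fun do rewrite eqbF_neg; exact: measurable_neg.
Qed.

End Functional.
End Measurability.

(** * Expected numbers of events *)

Section Shift.
Context {R : realType} (a : R).

Lemma measurable_shift : measurable_fun setT
  (fun z : measurableTypeR R => a + z : measurableTypeR R).
Proof.
have ma : measurable_fun [set: R] (fun z : R => a + z) by exact: measurable_funD.
exact: ma.
Qed.

Definition shift_mfun : {mfun measurableTypeR R >-> measurableTypeR R} :=
  HB.pack_for {mfun measurableTypeR R >-> measurableTypeR R}
    (fun z : R => a + z) (isMeasurableFun.Build _ _ _ _ _ measurable_shift).

Lemma lebesgue_measure_shift (A : set R) : measurable A ->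
  lebesgue_measure [set z | A (a + z)] = lebesgue_measure A.
Proof.
move=> mA; apply/esym; rewrite -[RHS]/(pushforward lebesgue_measure shift_mfun A).
apply: lebesgue_measure_unique => // _ [[b c] _ <-] /=.
rewrite /pushforward lebesgue_measure_itv/=.
rewrite [X in _ = lebesgue_measure X](_ : _ = `]b - a, c - a]%classic); last first.
  by rewrite eqEsubset; split => z /=; rewrite !in_itv/= ltrBlDl lerBrDl.
rewrite lebesgue_measure_itv/= !lte_fin ltrD2r; case: ifP => // _.
by rewrite -!EFinB; congr EFin; lra.
Qed.

End Shift.

Section AlmostEverywhere.
Context d (T : measurableType d) (R : realType) (P : {measure set T -> \bar R}).

Lemma measure_ae_iff (A B : set T) : measurable A -> measurable B ->
  {ae P, forall w, A w <-> B w} -> P A = P B.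
Proof.
move=> mA mB AB.
have diff0 (C D : set T) : measurable C -> measurable D ->
    {ae P, forall w, C w <-> D w} -> P (C `\` D) = 0.
  move=> mC mD CD; apply: measure_negligible; first exact: measurableD.
  apply: negligibleS CD => w [Cw nDw] /= [CDw _]; exact/nDw/CDw.
rewrite (measureDI P mA mB) [RHS](measureDI P mB mA).
apply: (congr2 (fun a b => a + b)%E); last by rewrite setIC.
transitivity (0 : \bar R); first exact: diff0.
apply/esym; apply: diff0 => //.
by move: AB; apply: filterS => w [? ?]; split.
Qed.

Lemma ae_measure0 (A : set T) : measurable A -> P A = 0 -> {ae P, forall w, ~ A w}.
Proof.
move=> mA A0; apply/(negligibleS _ (A := A)); last exact/negligibleP.
by move=> w /=; exact: contrapT.
Qed.

Lemma measure_ae_setU (A B : set T) : measurable A -> measurable B ->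
  {ae P, forall w, ~ (A w /\ B w)} -> P (A `|` B) = (P A + P B)%E.
Proof.
move=> mA mB AB; have -> : A `|` B = A `|` (B `\` A).
  rewrite eqEsubset; split => w [h|h]; [by left| |by left|].
    by have [?|?] := pselect (A w); [left|right].
  by right; case: h.
rewrite measureU; last first.
- by rewrite -subset0 => w [Aw [_ nAw]]; exact: nAw.
- exact: measurableD.
- exact: mA.
congr (_ + _)%E; apply: measure_ae_iff => //; first exact: measurableD.
by move: AB; apply: filterS => w ABw; split => [[]|Bw]//; split => // Aw; apply: ABw.
Qed.

Lemma measure_ae_series (A : set T) (F : nat -> set T) : measurable A ->
  (forall n, measurable (F n)) ->
  (forall w n m, F n w -> F m w -> n = m) ->
  {ae P, forall w, A w <-> exists n, F n w} -> P A = (\sum_(n <oo) P (F n))%E.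
Proof.
move=> mA mF tF AF; rewrite -measure_semi_bigcup//.
- apply: measure_ae_iff => //; first exact: bigcupT_measurable.
  by move: AF; apply: filterS => w ->; split=> [[n Fn]|[n _ Fn]]; exists n.
- by apply/trivIsetP => i j _ _ /eqP ij; rewrite -subset0 => w [Fi Fj]; exact/ij/(tF w).
- exact: bigcupT_measurable.
Qed.

End AlmostEverywhere.

Section ClockSums.
Context {R : realType} {d : measure_display} {Omega : measurableType d}.
Variables (P : probability Omega R) (I : eqType) (x : I -> {RV P >-> R}).
Variables (rate : R) (iota_ : nat -> I).
Hypotheses (indep : mutually_independent x) (x_gt0 : forall c w, 0 < x c w).
Hypotheses (rate_gt0 : 0 < rate) (inj : injective iota_).
Hypothesis law : forall n, has_exponential_law rate (x (iota_ n)).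

(** If the sum of [n] clocks is at most [N.+1], each of them is, which has
    probability [q ^+ n] for some [q < 1]. *)
Lemma clock_sum_unbounded :
  {ae P, forall w, forall T : R, exists n, T < \sum_(k < n) x (iota_ k) w}.
Proof.
pose A (N : nat) := \bigcap_n [set w | \sum_(k < n) x (iota_ k) w <= N.+1%:R].
have mle n (N : nat) : measurable [set w | \sum_(k < n) x (iota_ k) w <= N.+1%:R].
  apply: measurable_bool_set; apply: measurable_fun_ler => //.
  exact: measurable_sum.
have mA N : measurable (A N) by exact: bigcapT_measurable.
suff A0 N : P (A N) = 0.
  have : {ae P, forall w, forall N, ~ A N w}.
    by apply/ae_foralln => N; exact: (ae_measure0 (mA N) (A0 N)).
  apply: filterS => w nA T; apply: contrapT => /forallNP nT.
  apply: (nA (Num.truncn `|T|)) => n _ /=.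
  have /negP := nT n; rewrite -leNgt => /le_trans; apply.
  by rewrite (le_trans (ler_norm _))// ltW// truncnS_gt.
pose q := 1 - expR (- rate * N.+1%:R).
have q0 : 0 <= q.
  by rewrite subr_ge0 -[leRHS]expR0 ler_expR mulNr oppr_le0 mulr_ge0// ltW.
have q1 : q < 1 by rewrite ltrBlDr ltrDl expR_gt0.
have Pq n : P (x (iota_ n) @^-1` `]-oo, N.+1%:R]) = q%:E.
  rewrite (_ : _ @^-1` _ = ~` [set w | N.+1%:R < x (iota_ n) w]); last first.
    by rewrite eqEsubset; split => w /=; rewrite in_itv/= leNgt => /negP.
  rewrite probability_setC; last first.
    by apply: measurable_bool_set; exact: measurable_fun_ltr.
  by rewrite (exponential_gt (law n))// -EFinB.
have Ale n : (P (A N) <= (q ^+ n)%:E)%E.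
  have -> : (q ^+ n)%:E = P (\bigcap_(i in [set` map iota_ (iota 0 n)])
      (x i @^-1` `]-oo, N.+1%:R])).
    rewrite (indep (A := fun=> `]-oo, N.+1%:R]%classic))//; last first.
      by rewrite map_inj_uniq// iota_uniq.
    rewrite big_map; under eq_bigr do rewrite Pq.
    by rewrite prodEFin big_const_seq count_predT size_iota iter_mulr_1.
  apply: le_measure; rewrite ?inE//.
    apply: (@fin_bigcap_measurable _ _ _ [set` map iota_ (iota 0 n)]).
      exact: finite_seq.
    by move=> i _; rewrite -[_ @^-1` _]setTI; exact: measurable_funP.
  move=> w Aw _ /= /mapP[k _ ->]; rewrite in_itv/=.
  have := Aw k.+1 Logic.I; rewrite /= big_ord_recr/=; apply: le_trans.
  by rewrite lerDr; apply: sumr_ge0 => i _; exact: ltW.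
apply/eqP; rewrite -measure_le0.
have qn : (fun n => (q ^+ n)%:E) @ \oo --> 0%E.
  by apply: cvg_EFin; [exact: nearW|apply: cvg_expr; rewrite ger0_norm].
have <- : limn (fun n => (q ^+ n)%:E) = 0%E by exact/cvg_lim.
apply: lime_ge; first by apply/cvg_ex; exists 0%E.
exact: nearW.
Qed.

End ClockSums.

(** ** Events and time spent in each state *)

Section Model.
Context {R : realType} {d : measure_display} {Omega : measurableType d}.
Variables (P : probability Omega R) (x : clock -> {RV P >-> R}).
Variables (mu1 mu2 lam tau : R) (pi : policy R).

Definition rate (c : clock) : R :=
  match c with inl (inl _) => mu2 | inl (inr _) => mu1 | inr _ => lam end.

Hypotheses (mu1_gt0 : 0 < mu1) (mu2_gt0 : 0 < mu2) (lam_gt0 : 0 < lam).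
Hypotheses (tau_gt0 : 0 < tau) (mpi : measurable_policy tau pi).
Hypotheses (indep : mutually_independent x) (x_gt0 : forall c w, 0 < x c w).
Hypothesis law : forall c, has_exponential_law (rate c) (x c).

Notation mu := (@lebesgue_measure R).
Notation conf w := (fun c => x c w).
Notation observed := (observed tau pi).
Notation inst := (inst tau pi).
Notation wear := (wear tau pi).
Notation fail := (fail tau pi).
Notation hit := (hit tau pi).

Let mx c : measurable_fun setT (x c). Proof. by []. Qed.

Let rate_gt0 c : 0 < rate c. Proof. by case: c => [[]|] ?. Qed.

Let clock_gt0 w : forall c, 0 < conf w c. Proof. by move=> c; exact: x_gt0. Qed.

Definition regular (w : Omega) : Prop :=
  (forall T : R, exists n, T < uso (conf w) n) /\
  (forall T : R, exists n, T < \sum_(k < n) sojourn2 (conf w) k).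

Lemma ae_regular : {ae P, forall w, regular w}.
Proof.
have h1 : {ae P, forall w, forall T : R, exists n, T < uso (conf w) n}.
  apply: (clock_sum_unbounded (rate := lam) (iota_ := fun n => inr n)) => //.
    by move=> n m [].
  by move=> n; exact: law.
have h2 : {ae P, forall w, forall T : R, exists n, T < \sum_(k < n) sojourn2 (conf w) k}.
  apply: (clock_sum_unbounded (rate := mu2) (iota_ := fun n => inl (inl n))) => //.
    by move=> n m [].
  by move=> n; exact: law.
by move: h1 h2; apply: filterS2 => w; split.
Qed.

(** The law of a clock has no atom, hence neither has the law of its sum with
    a quantity that does not depend on it. *)
Lemma clock_atomless c (base : (clock -> R) -> R) u :
  measurable_functional base ->
  (forall v z, base (update v c z) = base v) ->
  P [set w | base (conf w) + x c w == u] = 0.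
Proof.
move=> mbase baseE.
rewrite (compensator indep (rate_gt0 c) (law c) (phi := fun v => base v + v c == u)).
  rewrite integral0_eq ?mule0// => w _ /=.
  apply/eqP; rewrite -measure_le0 -(@lebesgue_measure_set1 _ (u - base (conf w))).
  apply: le_measure; rewrite ?inE//.
    apply: measurable_bool_set; apply: measurable_and.
      exact: measurable_fun_ltr.
    apply: measurable_and; first exact: measurable_fun_ltr.
    apply: measurable_fun_eqr => //; apply: measurable_funD.
      by under eq_fun do rewrite baseE; exact: measurable_cst.
    by under eq_fun do rewrite update_same; exact: measurable_id.
  move=> z /= /and3P[_ _ /eqP]; rewrite baseE update_same => <-.
  by rewrite addrAC subrr add0r.
move=> d' T X mX; apply: measurable_fun_eqr => //.
by apply: measurable_funD; [exact: mbase|exact: mX].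
Qed.

Lemma ae_fail_neq u : {ae P, forall w, forall k, u <> fail (conf w) k}.
Proof.
apply/ae_foralln => k.
have mF : measurable [set w | wear (conf w) k + x (inl (inr k)) w == u].
  apply: measurable_bool_set; apply: measurable_fun_eqr => //.
  by apply: measurable_funD => //; exact: measurable_wear.
have F0 : P [set w | wear (conf w) k + x (inl (inr k)) w == u] = 0.
  apply: (clock_atomless (base := fun v => wear v k)).
    by move=> d' T X mX; exact: measurable_wear.
  by move=> v z; exact: wear_update_sojourn1.
move: (ae_measure0 mF F0); apply: filterS => w h uF; apply: h => /=.
by rewrite uF.
Qed.

Lemma ae_uso_neq u : {ae P, forall w, forall n, uso (conf w) n.+1 <> u}.
Proof.
apply/ae_foralln => n.
have mF : measurable [set w | uso (conf w) n + x (inr n) w == u].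
  apply: measurable_bool_set; apply: measurable_fun_eqr => //.
  by apply: measurable_funD => //; exact: measurable_uso.
have F0 : P [set w | uso (conf w) n + x (inr n) w == u] = 0.
  apply: (clock_atomless (base := fun v => uso v n)).
    by move=> d' T X mX; exact: measurable_uso.
  by move=> v z; rewrite uso_update_gap.
move: (ae_measure0 mF F0); apply: filterS => w h uF; apply: h => /=.
by rewrite -usoS uF.
Qed.

Lemma measurable_observed_at k i u : measurable [set w | observed (conf w) k i u].
Proof. by apply: measurable_bool_set; exact: measurable_observed. Qed.

Definition prob i (u : R) : \bar R :=
  (\sum_(k <oo) P [set w | observed (conf w) k i u])%E.

Lemma prob_ge0 i u : (0 <= prob i u)%E.
Proof. exact: nneseries_ge0. Qed.

Lemma measurable_pobserved k i :
  measurable_fun setT (fun u => P [set w | observed (conf w) k i u]).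
Proof.
apply: (measurable_fun_section1 P (b := fun z : R * Omega => observed (conf z.2) k i z.1)).
apply: (@measurable_observed _ _ _ tau_gt0 mpi _ _ (fun c (z : R * Omega) => x c z.2)) => //.
by move=> c; apply: measurableT_comp.
Qed.

Lemma measurable_prob i : measurable_fun setT (prob i).
Proof.
apply: ge0_emeasurable_sum => // k _; exact: measurable_pobserved.
Qed.

Lemma occupation k i (b : Omega * R -> bool) : measurable_fun setT b ->
  (\int[P]_w mu [set u | b (w, u) && observed (conf w) k i u] =
   \int[mu]_u P [set w | b (w, u) && observed (conf w) k i u])%E.
Proof.
move=> mb; apply: (tonelli_bool P mu (b := fun z => b z && observed (conf z.1) k i z.2)).
apply: measurable_and => //.
apply: (@measurable_observed _ _ _ tau_gt0 mpi _ _ (fun c (z : Omega * R) => x c z.1)) => //.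
by move=> c; apply: measurableT_comp.
Qed.

Lemma occupation_in k i (B : set R) : measurable B ->
  (\int[P]_w mu [set u | (u \in B) && observed (conf w) k i u] =
   \int[mu]_(u in B) P [set w | observed (conf w) k i u])%E.
Proof.
move=> mB; rewrite (occupation _ _ (b := fun z => z.2 \in B)).
  rewrite [RHS]integral_mkcond; apply: eq_integral => u _ /=; rewrite patchE.
  case: ifP => //= _.
  by rewrite (_ : [set w | _] = set0) ?measure0// -subset0.
apply: measurableT_comp => //; exact: measurable_fun_in.
Qed.

(** The ages that the first sojourn time of component [k] has passed are the
    instants at which this component is observed in state 2, so the compensator
    of this clock is the time spent there. *)
Lemma wear_count (B : set R) : measurable B ->
  (\sum_(k <oo) P [set w | (wear (conf w) k <= inst (conf w) k.+1)%R
                          && (wear (conf w) k \in B)]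
   = mu2%:E * \int[mu]_(u in B) prob Perfect u)%E.
Proof.
move=> mB; rewrite /prob integral_nneseries//; last first.
  by move=> k; apply: measurable_funTS; exact: measurable_pobserved.
rewrite -nneseriesZl; last by move=> k _; exact: integral_ge0.
apply: eq_eseriesr => k _.
rewrite (compensator indep (rate_gt0 _) (law (inl (inl k)))
  (phi := fun v => (wear v k <= inst v k.+1) && (wear v k \in B))); last first.
  move=> d' T X mX; apply: measurable_and.
    by apply: measurable_fun_ler; [exact: measurable_wear|exact: measurable_inst].
  apply: (measurableT_comp (measurable_fun_in mB)); exact: measurable_wear.
congr (_ * _)%E; rewrite -occupation_in//; apply: eq_integral => w _.
rewrite -[RHS](lebesgue_measure_shift (inst (conf w) k)); last first.
  apply: measurable_bool_set; apply: measurable_and.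
    exact: measurable_fun_in.
  exact: (@measurable_observed _ _ _ tau_gt0 mpi _ _ (fun c (_ : R) => x c w)).
have wearE z := wear_update_sojourn2 tau pi (conf w) k z.
congr (mu _); rewrite eqEsubset; split => z /=.
  move=> /and3P[z0 zx]; rewrite wearE => /andP[h ->] /=.
  by rewrite -(observed_wear tau pi (clock_gt0 w)).
move=> /andP[zB h]; have /and4P[] := h; rewrite ltrDl => z0 _ _.
rewrite eqb_id => zw.
have zx : z < x (inl (inl k)) w by move: zw; rewrite ltrD2l.
apply/and3P; split=> //; rewrite wearE zB andbT.
by rewrite (observed_wear tau pi (clock_gt0 w)).
Qed.

(** The same for the second sojourn time and state 1. *)
Lemma fail_count (B : set R) : measurable B ->
  (\sum_(k <oo) P [set w | failed tau pi (conf w) k && (fail (conf w) k \in B)]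
   = mu1%:E * \int[mu]_(u in B) prob Satisfactory u)%E.
Proof.
move=> mB; rewrite /prob integral_nneseries//; last first.
  by move=> k; apply: measurable_funTS; exact: measurable_pobserved.
rewrite -nneseriesZl; last by move=> k _; exact: integral_ge0.
apply: eq_eseriesr => k _.
rewrite (compensator indep (rate_gt0 _) (law (inl (inr k)))
  (phi := fun v => failed tau pi v k && (fail v k \in B))); last first.
  move=> d' T X mX; apply: measurable_and.
    by apply: measurable_fun_eqr; [exact: measurable_inst|exact: measurable_fail].
  apply: (measurableT_comp (measurable_fun_in mB)); exact: measurable_fail.
congr (_ * _)%E; rewrite -occupation_in//; apply: eq_integral => w _.
have failE z := fail_update_sojourn1 tau pi (conf w) k z.
pose D := [set u | (u \in B) && observed (conf w) k Satisfactory u].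
have mD0 : measurable D.
  apply: measurable_bool_set; apply: measurable_and.
    exact: measurable_fun_in.
  exact: (@measurable_observed _ _ _ tau_gt0 mpi _ _ (fun c (_ : R) => x c w)).
have mD : measurable [set z | D (wear (conf w) k + z)].
  have ma : measurable_fun setT (fun z : R => wear (conf w) k + z).
    exact: measurable_funD.
  by rewrite -[X in measurable X]setTI; exact: (ma measurableT _ mD0).
rewrite -[RHS](lebesgue_measure_shift (wear (conf w) k) mD0).
(* the instant at which the condition changes is observed but has z = 0 *)
transitivity (mu ([set z | D (wear (conf w) k + z)] `&` ~` [set 0])).
  congr (mu _); rewrite eqEsubset; split => z /=.
    move=> /and3P[z0 zx]; rewrite /failed failE => /andP[h zB].
    split; last by apply/eqP; rewrite gt_eqF.
    by rewrite /D/= zB -(observed_fail tau pi (clock_gt0 w)).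
  move=> [/andP[zB h] zn0]; have /and4P[_ zf _] := h; rewrite eqbF_neg -leNgt lerDl => z0.
  have zx : z < x (inl (inr k)) w by move: zf; rewrite ltrD2l.
  have {zn0}z0 : 0 < z by rewrite lt_neqAle eq_sym z0 andbT; apply/eqP.
  apply/and3P; split=> //; rewrite /failed failE zB andbT.
  by rewrite (observed_fail tau pi (clock_gt0 w)).
apply: measure_ae_iff => //.
  by apply: measurableI => //; exact: measurableC.
exists [set 0]; split => //; first exact: lebesgue_measure_set1.
move=> z /= nz; apply: contrapT => z0; apply: nz.
by split => [[]|Dz].
Qed.

(** The instants that the [n]-th gap has passed lie between two successive
    unscheduled opportunities; summing over [n] recovers the whole time axis. *)
Lemma uso_count k i (B : set R) : measurable B ->
  (\sum_(n <oo) P [set w | observed (conf w) k i (uso (conf w) n.+1)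
                          && (uso (conf w) n.+1 \in B)]
   = lam%:E * \int[mu]_(u in B) P [set w | observed (conf w) k i u])%E.
Proof.
move=> mB.
pose between n (z : Omega * R) : bool :=
  [&& uso (conf z.1) n < z.2, z.2 < uso (conf z.1) n.+1 & z.2 \in B].
have mbetween n : measurable_fun setT (between n).
  have muso m : measurable_fun setT (fun z : Omega * R => uso (conf z.1) m).
    apply: (@measurable_uso _ _ _ (fun c (z : Omega * R) => x c z.1)) => c.
    exact: measurableT_comp.
  apply: measurable_and; first exact: measurable_fun_ltr.
  apply: measurable_and; first exact: measurable_fun_ltr.
  by apply: (measurableT_comp (measurable_fun_in mB)).
have per n : P [set w | observed (conf w) k i (uso (conf w) n.+1)
                          && (uso (conf w) n.+1 \in B)] =
   (lam%:E * \int[mu]_u P [set w | between n (w, u) && observed (conf w) k i u])%E.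
  rewrite (compensator indep (rate_gt0 _) (law (inr n))
    (phi := fun v => observed v k i (uso v n.+1) && (uso v n.+1 \in B))); last first.
    move=> d' T X mX; apply: measurable_and.
      by apply: measurable_observed => //; exact: measurable_uso.
    apply: (measurableT_comp (measurable_fun_in mB)); exact: measurable_uso.
  congr (_ * _)%E; rewrite -occupation//; apply: eq_integral => w _.
  rewrite -[RHS](lebesgue_measure_shift (uso (conf w) n)); last first.
    apply: measurable_bool_set; apply: measurable_and.
      by apply: (measurableT_comp (mbetween n)); apply: measurable_fun_pair.
    exact: (@measurable_observed _ _ _ tau_gt0 mpi _ _ (fun c (_ : R) => x c w)).
  have usoE z : uso (update (conf w) (inr n) z) n.+1 = uso (conf w) n + z.
    by rewrite usoS uso_update_gap// /gap update_same.
  congr (mu _); rewrite eqEsubset; split => z /=.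
    move=> /and3P[z0 zx]; rewrite usoE => /andP[h zB].
    rewrite -(observed_gap tau pi k i (clock_gt0 w) z0 zx) h andbT.
    by rewrite /between/= zB ltrDl z0 usoS ltrD2l zx.
  move=> /andP[/and3P[/=]]; rewrite ltrDl usoS ltrD2l => z0 zx zB h.
  apply/and3P; split=> //; rewrite usoE zB andbT.
  by rewrite (observed_gap tau pi k i (clock_gt0 w)).
under eq_eseriesr do rewrite per.
rewrite nneseriesZl; last by move=> n _; exact: integral_ge0.
congr (_ * _)%E; rewrite -integral_nneseries//; last first.
  move=> n.
  apply: (measurable_fun_section1 P (b := fun z : R * Omega =>
    between n (z.2, z.1) && observed (conf z.2) k i z.1)).
  apply: measurable_and.
    by apply: (measurableT_comp (mbetween n)); apply: measurable_fun_pair.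
  apply: (@measurable_observed _ _ _ tau_gt0 mpi _ _ (fun c (z : R * Omega) => x c z.2)) => //.
  by move=> c; apply: measurableT_comp.
rewrite [RHS]integral_mkcond; apply: eq_integral => u _ /=; rewrite patchE.
have mob n : measurable [set w | between n (w, u) && observed (conf w) k i u].
  apply: measurable_bool_set; apply: measurable_and.
    by apply: (measurableT_comp (mbetween n)); apply: measurable_fun_pair.
  exact: measurable_observed.
case: ifP => uB; last first.
  rewrite eseries0// => n _ _; rewrite (_ : [set w | _] = set0) ?measure0//.
  by rewrite -subset0 => w; rewrite /= /between/= uB !andbF.
apply/esym; apply: (measure_ae_series (P := P)) => //.
- exact: measurable_observed_at.
- move=> w n m /andP[/and3P[/= n1 n2 _] _] /andP[/and3P[/= m1 m2 _] _].
  have [nm|mn|//] := ltngtP n m.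
    have := lt_trans m1 n2; rewrite (uso_lt (clock_gt0 w)) ltnS => h.
    by rewrite ltnNge h in nm.
  have := lt_trans n1 m2; rewrite (uso_lt (clock_gt0 w)) ltnS => h.
  by rewrite ltnNge h in mn.
- move: ae_regular (ae_uso_neq u); apply: filterS2 => w [reg _] neq /=.
  split=> [obs|[n /andP[_ ->]//]].
  have u0 : 0 < u.
    by have /andP[Su _] := obs; exact: le_lt_trans (inst_ge0 _ _ (clock_gt0 w) k) Su.
  have ex : exists n, u < uso (conf w) n by exact: reg.
  have [[|n] un nmin] := ex_minnP ex.
    by have := lt_trans u0 un; rewrite /uso big_ord0 ltxx.
  exists n; rewrite obs andbT /between/= un uB andbT lt_neqAle.
  rewrite (_ : uso _ _ <= u); last by rewrite leNgt; apply/negP => /nmin; rewrite ltnn.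
  case: n {un nmin} => [|n].
    by rewrite /uso big_ord0 lt_eqF.
  by rewrite !andbT; apply/eqP; exact: neq.
Qed.

(** ** Replacements and balance *)

Notation so m := (m.+1%:R * tau)%R.

(** Almost surely a component is in use at time [u], as installation times do
    not accumulate, and it does not fail at that very time. *)
Lemma prob_sum u : 0 < u -> (prob Perfect u + prob Satisfactory u = 1)%E.
Proof.
move=> u0; rewrite -nneseriesD//.
pose A k := [set w | observed (conf w) k Perfect u] `|`
            [set w | observed (conf w) k Satisfactory u].
have mA k : measurable (A k) by apply: measurableU; exact: measurable_observed_at.
have -> : (\sum_(k <oo) (P [set w | observed (conf w) k Perfect u] +
    P [set w | observed (conf w) k Satisfactory u]) = \sum_(k <oo) P (A k))%E.
  apply: eq_eseriesr => k _; rewrite measureU//.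
  - exact: measurable_observed_at.
  - exact: measurable_observed_at.
  - rewrite -subset0 => w [/= h1 h2].
    by have [] := observed_unique (clock_gt0 w) h1 h2.
rewrite -(@probability_setT _ _ _ P); apply/esym.
apply: (measure_ae_series (P := P)) => //.
- by move=> w n m [h1|h1] [h2|h2]; have [] := observed_unique (clock_gt0 w) h1 h2.
- move: ae_regular (ae_fail_neq u); apply: filterS2 => w [reg1 reg2] neq.
  split=> // _.
  have [k [[] h]] := observed_exists tau_gt0 (clock_gt0 w) reg1 reg2 u0 neq.
    by exists k; left.
  by exists k; right.
Qed.

Lemma prob_nonpos i u : u <= 0 -> prob i u = 0.
Proof.
move=> u0; apply: eseries0 => k _ _; rewrite (_ : [set w | _] = set0) ?measure0//.
rewrite -subset0 => w /= /andP[Su _].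
have := lt_le_trans Su u0.
by rewrite ltNge (inst_ge0 _ _ (clock_gt0 w)).
Qed.

Lemma prob_le1 i u : (prob i u <= 1)%E.
Proof.
have [u0|u0] := leP u 0; first by rewrite prob_nonpos.
rewrite -(prob_sum u0); case: i.
  by rewrite leeDl// prob_ge0.
by rewrite leeDr// prob_ge0.
Qed.

Lemma measurable_replacement k (b : R -> bool) : measurable_fun setT b ->
  measurable_fun setT (fun w => b (inst (conf w) k.+1)).
Proof. by move=> mb; apply: (measurableT_comp mb); exact: measurable_inst. Qed.

Lemma measurable_removed k i :
  measurable_fun setT (fun w => removed tau pi (conf w) k i).
Proof.
apply: measurable_and.
  by apply: measurable_fun_ltr; [exact: measurable_inst|exact: measurable_fail].
have mSW : measurable_fun setT (fun w => inst (conf w) k.+1 < wear (conf w) k).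
  by apply: measurable_fun_ltr; [exact: measurable_inst|exact: measurable_wear].
case: i => /=; first by under eq_fun do rewrite eqb_id.
by under eq_fun do rewrite eqbF_neg; exact: measurable_neg.
Qed.

(** A component removed before its failure is removed at exactly one
    opportunity, which almost surely is not both scheduled and unscheduled. *)
Lemma removal_count_component k i (B : set R) : measurable B ->
  (P [set w | removed tau pi (conf w) k i && (inst (conf w) k.+1 \in B)] =
   \sum_(n <oo) P [set w | observed (conf w) k i (uso (conf w) n.+1)
                          && (uso (conf w) n.+1 \in B `&` hit i)] +
   \sum_(m <oo) if replaces pi i SO 0 && (so m \in B)
                then P [set w | observed (conf w) k i (so m)] else 0)%E.
Proof.
move=> mB; have mBH : measurable (B `&` hit i).
  by apply: measurableI => //; apply: measurable_bool_set; exact: measurable_hit.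
pose U n := [set w | observed (conf w) k i (uso (conf w) n.+1)
                     && (uso (conf w) n.+1 \in B `&` hit i)].
pose S m := if replaces pi i SO 0 && (so m \in B)
            then [set w | observed (conf w) k i (so m)] else set0.
have mU n : measurable (U n).
  apply: measurable_bool_set; apply: measurable_and.
    by apply: measurable_observed => //; exact: measurable_uso.
  apply: (measurableT_comp (measurable_fun_in mBH)); exact: measurable_uso.
have mS m : measurable (S m).
  by rewrite /S; case: ifP => // _; exact: measurable_observed_at.
have Ueq n w : U n w -> inst (conf w) k.+1 = uso (conf w) n.+1 /\
    removed tau pi (conf w) k i.
  move=> /andP[obs /set_mem[_ h]]; apply: observed_replace => //.
  by apply/replace_atP; right; split => //; exists n.
have Seq m w : S m w -> inst (conf w) k.+1 = so m /\
    removed tau pi (conf w) k i.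
  rewrite /S; case: ifP => // /andP[repl _] obs; apply: observed_replace => //.
  by apply/replace_atP; left; split => //; exists m.
transitivity (P (\bigcup_n U n `|` \bigcup_m S m)).
  apply: measure_ae_iff.
  - apply: measurable_bool_set; apply: measurable_and.
      exact: measurable_removed.
    by apply: measurable_replacement; exact: measurable_fun_in.
  - by apply: measurableU; exact: bigcupT_measurable.
  move: ae_regular; apply: filterS => w [reg _] /=; split.
    move=> /andP[/(removedP tau_gt0 (clock_gt0 w) reg)[obs +] SB].
    move=> [[[m mE] repl]|[[n nE] h]].
      by right; exists m => //; rewrite /S repl -mE SB.
    left; exists n => //; rewrite /U/= -nE obs/=.
    by apply/mem_set; split => //; exact: set_mem.
  move=> [[n _ Un]|[m _ Sm]].
    have [SE rem] := Ueq _ _ Un; rewrite rem SE/=.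
    by have /andP[_ /set_mem[/mem_set]] := Un.
  have [SE rem] := Seq _ _ Sm; rewrite rem SE/=.
  by move: Sm; rewrite /S; case: ifP => // /andP[].
rewrite measure_ae_setU; last first.
- have : {ae P, forall w, forall m n, uso (conf w) n.+1 <> so m}.
    by apply/ae_foralln => m; exact: ae_uso_neq.
  apply: filterS => w neq [[n _ Un] [m _ Sm]]; apply: (neq m n).
  by have [<- _] := Ueq _ _ Un; have [<- _] := Seq _ _ Sm.
- exact: bigcupT_measurable.
- exact: bigcupT_measurable.
congr (_ + _)%E.
  apply: (measure_ae_series (P := P)) => //.
  - exact: bigcupT_measurable.
  - move=> w n m /Ueq[SEn _] /Ueq[SEm _].
    have nm : uso (conf w) n.+1 = uso (conf w) m.+1 by rewrite -SEn -SEm.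
    have [h|h|//] := ltngtP n m.
      have : uso (conf w) n.+1 < uso (conf w) m.+1 by rewrite (uso_lt (clock_gt0 w)).
      by rewrite nm ltxx.
    have : uso (conf w) m.+1 < uso (conf w) n.+1 by rewrite (uso_lt (clock_gt0 w)).
    by rewrite nm ltxx.
  - by apply: aeW => w; split=> [[n _ Un]|[n Un]]; exists n.
transitivity (\sum_(m <oo) P (S m))%E.
  apply: (measure_ae_series (P := P)) => //.
  - exact: bigcupT_measurable.
  - move=> w n m /Seq[SEn _] /Seq[SEm _].
    have /(mulIf (lt0r_neq0 tau_gt0))/eqP : so n = so m by rewrite -SEn -SEm.
    by rewrite eqr_nat eqSS => /eqP.
  - by apply: aeW => w; split=> [[n _ Un]|[n Un]]; exists n.
by apply: eq_eseriesr => m _; rewrite /S; case: ifP => // _; rewrite measure0.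
Qed.

Lemma removal_count i (B : set R) : measurable B ->
  (\sum_(k <oo) P [set w | removed tau pi (conf w) k i && (inst (conf w) k.+1 \in B)] =
   lam%:E * \int[mu]_(u in B `&` hit i) prob i u +
   \sum_(m <oo) if replaces pi i SO 0 && (so m \in B)
                then prob i (so m) else 0)%E.
Proof.
move=> mB; have mBH : measurable (B `&` hit i).
  by apply: measurableI => //; apply: measurable_bool_set; exact: measurable_hit.
under eq_eseriesr do rewrite (removal_count_component _ _ mB).
rewrite nneseriesD; last 2 first.
- by move=> k _ _; exact: nneseries_ge0.
- by move=> k _ _; apply: nneseries_ge0 => m _ _; case: ifP.
congr (_ + _)%E.
  under eq_eseriesr do rewrite (uso_count _ _ mBH).
  rewrite nneseriesZl; last by move=> k _; exact: integral_ge0.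
  congr (_ * _)%E; rewrite /prob integral_nneseries// => k.
  by apply: measurable_funTS; exact: measurable_pobserved.
rewrite nneseries_interchange; last by move=> k m; case: ifP.
apply: eq_eseriesr => m _; case: ifP => // _.
by rewrite eseries0.
Qed.

Lemma balance_equation (T : R) :
  (\sum_(k <oo) P [set w | (wear (conf w) k <= inst (conf w) k.+1)%R
                          && (wear (conf w) k \in `]0%R, T])] =
   prob Satisfactory T +
   \sum_(k <oo) P [set w | failed tau pi (conf w) k && (fail (conf w) k \in `]0%R, T])] +
   \sum_(k <oo) P [set w | removed tau pi (conf w) k Satisfactory
                          && (inst (conf w) k.+1 \in `]0%R, T[)])%E.
Proof.
rewrite -nneseriesD// -nneseriesD//; last by move=> k _ _; rewrite adde_ge0.
apply: eq_eseriesr => k _.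
have mB : measurable_fun setT (fun w => failed tau pi (conf w) k
    && (fail (conf w) k \in `]0%R, T])).
  apply: measurable_and.
    by apply: measurable_fun_eqr; [exact: measurable_inst|exact: measurable_fail].
  have mI : measurable_fun setT (fun y : R => y \in `]0%R, T]).
    by apply: measurable_and; [exact: measurable_fun_ltr|exact: measurable_fun_ler].
  by apply: (measurableT_comp mI); exact: measurable_fail.
have mC : measurable_fun setT (fun w => removed tau pi (conf w) k Satisfactory
    && (inst (conf w) k.+1 \in `]0%R, T[)).
  apply: measurable_and; first exact: measurable_removed.
  apply: (measurable_replacement _ (b := fun y => y \in `]0%R, T[)).
  by apply: measurable_and; exact: measurable_fun_ltr.
rewrite -measureU; last first.
- rewrite -subset0 => w [/= obs /andP[_ fT]]; have /and4P[_ TF _ _] := obs.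
  by move: fT; rewrite in_itv/= [_ <= T]leNgt TF andbF.
- exact: measurable_bool_set.
- exact: measurable_observed_at.
rewrite -measureU; last first.
- rewrite -subset0 => w [[/= obs|/= /andP[fl _]] /andP[rm S0T]].
    have /and4P[_ _ TS _] := obs.
    by move: S0T; rewrite in_itv/= [_ < T]ltNge TS andbF.
  by move: rm fl; rewrite /removed /failed lt_neqAle => /andP[/andP[/negP h _] _] /h.
- exact: measurable_bool_set.
- by apply: measurableU; [exact: measurable_observed_at|exact: measurable_bool_set].
congr (P _); apply/funext => w /=.
have := balance tau pi k T (clock_gt0 w).
have S0 := inst_ge0 tau pi (clock_gt0 w) k.
have W0 : 0 < wear (conf w) k by exact: le_lt_trans S0 (inst_lt_wear _ _ (clock_gt0 w) k).
have F0 : 0 < fail (conf w) k by exact: lt_trans W0 (wear_lt_fail _ _ (clock_gt0 w) k).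
have S'0 : removed tau pi (conf w) k Satisfactory -> 0 < inst (conf w) k.+1.
  by move=> /andP[_]; rewrite eqbF_neg -leNgt; exact: lt_le_trans.
rewrite !in_itv/= W0 F0/=.
have -> : (removed tau pi (conf w) k Satisfactory &&
   ((0 < inst (conf w) k.+1) && (inst (conf w) k.+1 < T))) =
   (removed tau pi (conf w) k Satisfactory && (inst (conf w) k.+1 < T)).
  by case: (removed _ _ _ _ _) S'0 => //= ->.
exact: or3_of_sum.
Qed.

(** ** Real-valued forms *)

Definition freq i (u : R) : R := fine (prob i u).

Lemma freqE i u : prob i u = (freq i u)%:E.
Proof.
rewrite /freq fineK// ge0_fin_numE ?prob_ge0//.
by rewrite (le_lt_trans (prob_le1 _ _))// ltry.
Qed.

Lemma freq_ge0 i u : 0 <= freq i u.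
Proof. by rewrite -lee_fin -freqE prob_ge0. Qed.

Lemma freq_le1 i u : freq i u <= 1.
Proof. by rewrite -lee_fin -freqE prob_le1. Qed.

Lemma measurable_freq i : measurable_fun setT (freq i).
Proof.
apply/measurable_EFinP; rewrite (_ : EFin \o _ = prob i); last first.
  by apply/funext => u; rewrite /= freqE.
exact: measurable_prob.
Qed.

Lemma freq_perfect u : 0 < u -> freq Perfect u = 1 - freq Satisfactory u.
Proof.
move=> /prob_sum; rewrite !freqE -EFinD => -[<-]; by rewrite addrK.
Qed.

Lemma integral_freq (f : R -> R) (T : R) : measurable_fun setT f ->
  (forall u, 0 <= f u <= 1) ->
  (\int[mu]_(u in `]0%R, T]) (f u)%:E = (\int[mu]_(u in `]0%R, T]) f u)%:E)%E.
Proof.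
move=> mf f01.
have muT : (lebesgue_measure (`]0%R, T]%classic : set R) < +oo)%E.
  by rewrite lebesgue_measure_itv/=; case: ifP => // _; rewrite -EFinB ltry.
rewrite /Rintegral fineK// integrable_fin_num//.
apply: measurable_bounded_integrable => //.
- exact: measurable_funTS.
exists 1; split => // M M1 u _ /=; have /andP[f0 f1] := f01 u.
by rewrite ger0_norm// (le_trans f1)// ltW.
Qed.

Lemma integral_prob i T :
  (\int[mu]_(u in `]0%R, T]) prob i u = (\int[mu]_(u in `]0%R, T]) freq i u)%:E)%E.
Proof.
rewrite -integral_freq; last 2 first.
- exact: measurable_freq.
- by move=> u; rewrite freq_ge0 freq_le1.
by apply: eq_integral => u _; exact: freqE.
Qed.

Lemma integral_prob_hit i T :
  (\int[mu]_(u in `]0%R, T] `&` hit i) prob i u =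
   (\int[mu]_(u in `]0%R, T]) ((hit i u)%:R * freq i u))%:E)%E.
Proof.
rewrite integral_mkcondr -integral_freq; last 2 first.
- apply: measurable_funM; last exact: measurable_freq.
  by apply: measurable_natr_bool; exact: measurable_hit.
- move=> u; case: (hit i u); rewrite ?mul1r ?mul0r ?lexx ?ler01//.
  by rewrite freq_ge0 freq_le1.
apply: eq_integral => u _; rewrite patchE freqE.
case: ifP => [/set_mem h|/negP h]; first by rewrite [hit i u](_ : _ = true)// mul1r.
by rewrite [hit i u](_ : _ = false) ?mul0r//; apply/negP => hu; apply: h; apply/mem_set.
Qed.

Lemma integral_prob_hit_oo i T :
  (\int[mu]_(u in `]0%R, T[ `&` hit i) prob i u =
   (\int[mu]_(u in `]0%R, T]) ((hit i u)%:R * freq i u))%:E)%E.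
Proof.
rewrite -integral_prob_hit !integral_mkcondr integral_itv_bndo_bndc//.
apply: measurable_funTS; apply/(measurable_restrictT _ _).1.
  by apply: measurable_bool_set; exact: measurable_hit.
by apply: measurable_funTS; exact: measurable_prob.
Qed.

Lemma so_series i (B : set R) M : (forall m, (so m \in B) = (m < M)%N) ->
  (\sum_(m <oo) (if replaces pi i SO 0 && (so m \in B) then prob i (so m) else 0) =
   (\sum_(m < M) ((replaces pi i SO 0)%:R * freq i (so m)))%:E)%E.
Proof.
move=> BM; rewrite (@nneseries_split _ _ 0 M); last first.
  by move=> k _; case: ifP => // _; exact: prob_ge0.
rewrite [X in (_ + X)%E]eseries0 ?adde0; last first.
  by move=> k; rewrite add0n => Mk _; rewrite BM ltnNge Mk andbF.
rewrite add0n big_mkord -sumEFin; apply: eq_bigr => m _.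
rewrite BM ltn_ord andbT; case: replaces => /=; rewrite ?mul0r// mul1r.
exact: freqE.
Qed.

(** The visits to state 1 started by time [T] are still going on, or ended in a
    failure, or in a replacement; the intensities of entries, failures and
    unscheduled replacements turn their expected numbers into integrals. *)
Lemma freq_balance M T : M%:R * tau < T -> T <= M.+1%:R * tau ->
  freq Satisfactory T + mu1 * \int[mu]_(u in `]0, T]) freq Satisfactory u
  + lam * \int[mu]_(u in `]0, T]) ((hit Satisfactory u)%:R * freq Satisfactory u)
  + \sum_(m < M) ((replaces pi Satisfactory SO 0)%:R * freq Satisfactory (so m))
  = mu2 * \int[mu]_(u in `]0, T]) freq Perfect u.
Proof.
move=> MT TM; apply: EFin_inj; rewrite !EFinD !EFinM -!integral_prob.
rewrite -integral_prob_hit_oo -(@so_series _ `]0, T[%classic); last first.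
  move=> m; apply/idP/idP => [/set_mem|mM]; last apply/mem_set; rewrite /= in_itv/=.
    move=> /andP[_ /lt_le_trans/(_ TM)]; rewrite ltr_pM2r// ltr_nat.
    by rewrite ltnS.
  by rewrite mulr_gt0//= (le_lt_trans _ MT)// ler_pM2r// ler_nat.
rewrite -fail_count// -wear_count// -addeA -removal_count// -freqE.
by rewrite !mem_setE balance_equation.
Qed.

Lemma expected_total_cost (cp cc T : R) : 0 < cp -> 0 < cc ->
  (\int[P]_w total_cost tau cp cp cc pi (sojourn2 (conf w)) (sojourn1 (conf w))
      (gap (conf w)) T =
   cc%:E * \sum_(k <oo) P [set w | failed tau pi (conf w) k
                                  && (fail (conf w) k \in `]0%R, T])] +
   cp%:E * (\sum_(k <oo) P [set w | removed tau pi (conf w) k Perfect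
                                   && (inst (conf w) k.+1 \in `]0%R, T])] +
            \sum_(k <oo) P [set w | removed tau pi (conf w) k Satisfactory
                                   && (inst (conf w) k.+1 \in `]0%R, T])]))%E.
Proof.
move=> cp0 cc0.
pose F k := [set w | failed tau pi (conf w) k && (fail (conf w) k \in `]0%R, T])].
pose D i k := [set w | removed tau pi (conf w) k i
                      && (inst (conf w) k.+1 \in `]0%R, T])].
have mI : measurable_fun setT (fun y : R => y \in `]0%R, T]).
  by apply: measurable_and; [exact: measurable_fun_ltr|exact: measurable_fun_ler].
have mF k : measurable (F k).
  apply: measurable_bool_set; apply: measurable_and.
    by apply: measurable_fun_eqr; [exact: measurable_inst|exact: measurable_fail].
  by apply: (measurableT_comp mI); exact: measurable_fail.
have mD i k : measurable (D i k).
  apply: measurable_bool_set; apply: measurable_and; first exact: measurable_removed.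
  exact: (measurable_replacement _ mI).
have mInd (c : R) (A : set Omega) : measurable A ->
    measurable_fun setT (fun w => (c * \1_A w)%:E : \bar R).
  by move=> mA; apply/measurable_EFinP; apply: measurable_funM => //; exact: measurable_indic.
have iInd (c : R) (A : set Omega) : 0 <= c -> measurable A ->
    (\int[P]_w (c * \1_A w)%:E = c%:E * P A)%E.
  move=> c0 mA; under eq_integral do rewrite EFinM.
  have m1 : measurable_fun setT (fun w => (\1_A w)%:E : \bar R).
    rewrite (_ : (fun w => _) = EFin \o \1_A)//.
    by apply/measurable_EFinP; exact: measurable_indic.
  rewrite ge0_integralZl_EFin//.
  by rewrite integral_indic// setIT.
have instE w k : install_time tau pi (sojourn2 (conf w)) (sojourn1 (conf w))
   (gap (conf w)) k = inst (conf w) k by [].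
have inF w k : (w \in F k) = failed tau pi (conf w) k && (fail (conf w) k <= T).
  have F0 : 0 < fail (conf w) k.
    have := inst_ge0 tau pi (clock_gt0 w) k; move=> /le_lt_trans; apply.
    exact: (inst_lt_fail tau pi (clock_gt0 w)).
  by apply/idP/idP => [/set_mem|h]; last apply/mem_set; rewrite /F/= in_itv/= F0.
have inD w i k : (w \in D i k) = removed tau pi (conf w) k i && (inst (conf w) k.+1 <= T).
  have S0 : 0 < inst (conf w) k.+1 by exact: (inst_gt0 pi tau_gt0 k (clock_gt0 w)).
  by apply/idP/idP => [/set_mem|h]; last apply/mem_set; rewrite /D/= in_itv/= S0.
transitivity (\int[P]_w \sum_(k <oo) ((cc * \1_(F k) w)%:E + ((cp * \1_(D Perfect k) w)%:E
    + (cp * \1_(D Satisfactory k) w)%:E)))%E.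
  apply: eq_integral => w _; rewrite /total_cost eseries_mkcond.
  apply: eq_eseriesr => k _.
  rewrite !indicE inF !inD -!EFinD.
  rewrite (_ : install_time _ _ _ _ _ k.+1 = inst (conf w) k.+1)//.
  rewrite /replacement_cost (_ : install_time _ _ _ _ _ k.+1 = inst (conf w) k.+1)//.
  rewrite (_ : failure_time _ _ _ _ _ k = fail (conf w) k)// if_same.
  rewrite /failed /removed lt_neqAle (inst_le_fail tau pi) andbT.
  have [->|_] := eqVneq (inst (conf w) k.+1) (fail (conf w) k).
    by case: (_ <= T); rewrite ?mulr1 ?mulr0 ?addr0.
  case: (_ <= T); last by rewrite !andbF !mulr0 !addr0.
  by case: (_ < wear _ _); rewrite /= ?mulr1 ?mulr0 ?addr0 ?add0r.
have posInd (c : R) (A : set Omega) w : 0 < c -> (0 <= (c * \1_A w)%:E)%E.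
  by move=> c0; rewrite lee_fin mulr_ge0// ltW.
rewrite integral_nneseries//; last 2 first.
- by move=> k; do 2 (apply: emeasurable_funD; first exact: mInd); exact: mInd.
- by move=> k w _; rewrite !adde_ge0// posInd.
rewrite -!nneseriesZl// -nneseriesD//.
rewrite -nneseriesZl; last by move=> k _; rewrite adde_ge0.
rewrite -nneseriesD; last 2 first.
- by move=> k _ _; rewrite mule_ge0// lee_fin ltW.
- by move=> k _ _; rewrite mule_ge0// ?adde_ge0// lee_fin ltW.
apply: eq_eseriesr => k _.
rewrite ge0_integralD//; last 4 first.
- by move=> w _; exact: posInd.
- exact: mInd.
- by move=> w _; rewrite adde_ge0// posInd.
- by apply: emeasurable_funD; exact: mInd.
rewrite ge0_integralD//; last 4 first.
- by move=> w _; exact: posInd.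
- exact: mInd.
- by move=> w _; exact: posInd.
- exact: mInd.
rewrite !iInd ?ltW//.
by rewrite ge0_muleDr.
Qed.

(** Failures and unscheduled opportunities have constant intensities in each
    condition, which turns their expected numbers into integrals; the scheduled
    opportunities are at known times and leave a sum. *)
Lemma expected_total_cost_so (cp cc : R) M : 0 < cp -> 0 < cc ->
  (\int[P]_w total_cost tau cp cp cc pi (sojourn2 (conf w)) (sojourn1 (conf w))
      (gap (conf w)) (M%:R * tau) =
   (cc * (mu1 * \int[mu]_(u in `]0, M%:R * tau]) freq Satisfactory u) +
    cp * ((lam * \int[mu]_(u in `]0, M%:R * tau]) ((hit Perfect u)%:R * freq Perfect u)
           + \sum_(m < M) ((replaces pi Perfect SO 0)%:R * freq Perfect (so m)))
          + (lam * \int[mu]_(u in `]0, M%:R * tau])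
                     ((hit Satisfactory u)%:R * freq Satisfactory u)
           + \sum_(m < M) ((replaces pi Satisfactory SO 0)%:R
                           * freq Satisfactory (so m)))))%:E)%E.
Proof.
move=> cp0 cc0; rewrite expected_total_cost//.
have soM m : (so m \in `]0%R, (M%:R * tau)%R]%classic) = (m < M)%N.
  apply/idP/idP => [/set_mem|mM]; last apply/mem_set; rewrite /= in_itv/=.
    by move=> /andP[_]; rewrite ler_pM2r// ler_nat.
  by rewrite mulr_gt0//= ler_pM2r// ler_nat.
rewrite !(EFinD, EFinM) -!integral_prob -!integral_prob_hit.
rewrite -!(so_series _ soM) -fail_count// -!removal_count//.
by rewrite !mem_setE.
Qed.

End Model.

(** * Analysis of the balance equation *)

Section BoundedIntegrals.
Context {R : realType}.
Notation mu := (@lebesgue_measure R).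
Implicit Types (f g : R -> R) (a b c K : R).

Definition bounded_measurable f :=
  measurable_fun setT f /\ exists K, forall u, `|f u| <= K.

Notation I a b f := (\int[mu]_(u in `]a, b]) f u).

Lemma bounded_measurable_integrable a b f : bounded_measurable f ->
  mu.-integrable `]a, b] (EFin \o f).
Proof.
move=> [mf [K fK]].
have muab : (lebesgue_measure (`]a, b]%classic : set R) < +oo)%E.
  by rewrite lebesgue_measure_itv/=; case: ifP => // _; rewrite -EFinB ltry.
apply: measurable_bounded_integrable => //; first exact: measurable_funTS.
by exists K; split => [|M KM u _ /=]; [exact: num_real|rewrite (le_trans (fK u))// ltW].
Qed.

Lemma bounded_measurable_cst c : bounded_measurable (fun=> c).
Proof. by split => //; exists `|c|. Qed.

Lemma bounded_measurableD f g : bounded_measurable f -> bounded_measurable g ->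
  bounded_measurable (fun u => f u + g u).
Proof.
move=> [mf [K fK]] [mg [L gL]]; split; first exact: measurable_funD.
by exists (K + L) => u; rewrite (le_trans (ler_normD _ _))// lerD.
Qed.

Lemma bounded_measurableB f g : bounded_measurable f -> bounded_measurable g ->
  bounded_measurable (fun u => f u - g u).
Proof.
move=> [mf [K fK]] [mg [L gL]]; split; first exact: measurable_funB.
by exists (K + L) => u; rewrite (le_trans (ler_normB _ _))// lerD.
Qed.

Lemma bounded_measurableM f g : bounded_measurable f -> bounded_measurable g ->
  bounded_measurable (fun u => f u * g u).
Proof.
move=> [mf [K fK]] [mg [L gL]]; split; first exact: measurable_funM.
by exists (K * L) => u; rewrite normrM ler_pM.
Qed.

Lemma bounded_measurable_shift a f : bounded_measurable f ->
  bounded_measurable (fun u => f (a + u)).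
Proof.
move=> [mf [K fK]]; split; last by exists K.
by apply: (measurableT_comp mf); exact: measurable_funD.
Qed.

Lemma intD a b f g : bounded_measurable f -> bounded_measurable g ->
  I a b (fun u => f u + g u) = I a b f + I a b g.
Proof. by move=> bf bg; rewrite RintegralD//; exact: bounded_measurable_integrable. Qed.

Lemma intB a b f g : bounded_measurable f -> bounded_measurable g ->
  I a b (fun u => f u - g u) = I a b f - I a b g.
Proof. by move=> bf bg; rewrite RintegralB//; exact: bounded_measurable_integrable. Qed.

Lemma intZ a b f c : bounded_measurable f ->
  I a b (fun u => c * f u) = c * I a b f.
Proof. by move=> bf; rewrite RintegralZl//; exact: bounded_measurable_integrable. Qed.

Lemma int_cst a b c : a <= b -> I a b (fun=> c) = c * (b - a).
Proof.
move=> ab.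
transitivity (c * fine (lebesgue_measure (`]a, b]%classic : set R))).
  by rewrite Rintegral_cst.
rewrite lebesgue_measure_itv/= lte_fin.
by case: ltgtP ab => //= -> _; rewrite subrr.
Qed.

Lemma int_ge0 a b f : (forall u, a < u <= b -> 0 <= f u) -> 0 <= I a b f.
Proof. by move=> f0; apply: Rintegral_ge0 => u /=; rewrite in_itv/=; exact: f0. Qed.

Lemma int_le a b f g : bounded_measurable f -> bounded_measurable g ->
  (forall u, a < u <= b -> f u <= g u) -> I a b f <= I a b g.
Proof.
move=> bf bg fg; apply: le_Rintegral => //; exact: bounded_measurable_integrable.
Qed.

Lemma int_split a b c f : bounded_measurable f -> a <= b -> b <= c ->
  I a c f = I a b f + I b c f.
Proof.
move=> bf ab bc.
have := @Rintegral_itvB _ f (BRight a) (BRight c) b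
  (bounded_measurable_integrable a c bf).
by rewrite !bnd_simp => /(_ ab bc) <-; rewrite addrCA subrr addr0.
Qed.

Lemma int_shift a s f : bounded_measurable f ->
  I a (a + s) f = I 0 s (fun u => f (a + u)).
Proof.
move=> bf; rewrite /Rintegral; congr fine.
transitivity (\int[pushforward mu (shift_mfun a)]_(u in `]a, (a + s)%R]) (f u)%:E)%E.
  apply: eq_measure_integral => A mA _; apply/esym.
  exact: lebesgue_measure_shift.
have pre : shift_mfun a @^-1` `]a, a + s] = `]0, s]%classic.
  by rewrite eqEsubset; split => u /=; rewrite !in_itv/= ltrDl lerD2l.
rewrite (integral_pushforward (phi := shift_mfun a) (measurable_shift a) (mu := mu)) ?pre//.
  by apply/measurable_EFinP; case: bf.
exact: (bounded_measurable_integrable 0 s (bounded_measurable_shift a bf)).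
Qed.

End BoundedIntegrals.

Section Comparison.
Context {R : realType}.
Notation mu := (@lebesgue_measure R).
Notation I a b f := (\int[mu]_(u in `]a, b]) f u).

(** A function that can only increase while it is negative stays nonnegative:
    on the interval that follows its last nonnegative value it does not
    decrease. *)
Lemma nonneg_of_last_zero (F : R -> R) (D0 K t : R) : measurable_fun setT F ->
  (forall u, `|F u| <= K) -> 0 <= D0 -> 0 <= t ->
  (forall u, 0 < u <= t -> D0 + I 0 u F < 0 -> 0 <= F u) ->
  0 <= D0 + I 0 t F.
Proof.
move=> mF FK D00 t0 Fpos; pose D u := D0 + I 0 u F.
have bF : bounded_measurable F by split => //; exists K.
have K0 : 0 <= K by exact: le_trans (FK 0).
rewrite leNgt; apply/negP => Dt.
pose E := [set u | 0 <= u <= t /\ 0 <= D u].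
have D_0 : D 0 = D0 by rewrite /D set_itv_ge ?bnd_simp ?ltxx// Rintegral_set0 addr0.
have E0 : E 0 by split; rewrite ?lexx ?D_0.
have supE : has_sup E by split; [exists 0|exists t => u [/andP[]]].
set s := sup E.
have st : s <= t by apply: ge_sup; [exists 0|move=> u [/andP[]]].
have s0 : 0 <= s by apply: ub_le_sup => //; case: supE.
(* from a nonnegative value of [D] at distance less than [eps] before [s], the
   function [D] loses less than [K * eps] until [s] and nothing after [s] *)
pose eps := - D t / (K + 1).
have eps0 : 0 < eps by rewrite divr_gt0 ?oppr_gt0 ?ltr_pwDr.
have [u0 [/andP[u00 u0t] Du0] su0] := sup_adherent eps0 supE.
have {}su0 : s - eps < u0 := su0.
have u0s : u0 <= s by apply: ub_le_sup; [case: supE|split; rewrite ?u00].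
have DtE : D t = D u0 + I u0 s F + I s t F.
  by rewrite /D (int_split bF (le_trans u00 u0s) st) (int_split bF u00 u0s) !addrA.
have I1 : - (K * (s - u0)) <= I u0 s F.
  rewrite -mulNr -(int_cst _ u0s); apply: int_le => //.
    exact: bounded_measurable_cst.
  by move=> u _; have := FK u; rewrite ler_norml => /andP[].
have I2 : 0 <= I s t F.
  apply: int_ge0 => u /andP[su ut].
  have u_gt0 : 0 < u by exact: le_lt_trans su.
  apply: Fpos; first by rewrite u_gt0.
  rewrite ltNge; apply/negP => Du; move: su; rewrite ltNge => /negP; apply.
  by apply: ub_le_sup; [case: supE|split; rewrite ?ut ?(ltW u_gt0)].
have epsE : (K + 1) * eps = - D t.
  by rewrite /eps mulrC divfK// gt_eqF// ltr_pwDr.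
have : K * (s - u0) <= K * eps by rewrite ler_wpM2l//; lra.
move: Dt; rewrite -/(D t); nra.
Qed.

Variables (mu1 mu2 lam tau : R).
Hypotheses (mu1_gt0 : 0 < mu1) (mu2_gt0 : 0 < mu2) (lam_gt0 : 0 < lam).

(** The balance equation during one period between scheduled opportunities:
    [al] is the probability of state 1 at the beginning of the period and [h]
    tells when state 1 is left at unscheduled opportunities. *)
Definition solution (h : R -> bool) (al : R) (f : R -> R) : Prop :=
  [/\ measurable_fun setT f, forall u, 0 <= f u <= 1 &
    forall s, 0 < s <= tau -> f s = al + mu2 * s - (mu1 + mu2) * I 0 s f
                                  - lam * I 0 s (fun u => (h u)%:R * f u)].

Lemma bounded_measurable_bool (h : R -> bool) : measurable_fun setT h ->
  bounded_measurable (fun u => (h u)%:R : R).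
Proof.
move=> mh; split; first exact: measurable_natr_bool.
by exists 1 => u; case: (h u); rewrite ?normr1 ?normr0.
Qed.

Lemma bounded_measurable01 (f : R -> R) : measurable_fun setT f ->
  (forall u, 0 <= f u <= 1) -> bounded_measurable f.
Proof.
by move=> mf f01; split => //; exists 1 => u; have /andP[? ?] := f01 u; rewrite ger0_norm.
Qed.

(** While [g] is below [f], state 1 loses less probability and gains more for
    [g] than for [f], so that [g - f] increases. *)
Lemma solution_le (h h' : R -> bool) al al' f g :
  measurable_fun setT h -> measurable_fun setT h' ->
  (forall u, h' u -> h u) -> al <= al' ->
  solution h al f -> solution h' al' g -> forall s, 0 < s <= tau -> f s <= g s.
Proof.
move=> mh mh' hh' alal' [mf f01 fE] [mg g01 gE] s /andP[s0 stau].
have bf := bounded_measurable01 mf f01; have bg := bounded_measurable01 mg g01.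
have bh := bounded_measurable_bool mh; have bh' := bounded_measurable_bool mh'.
have bhf := bounded_measurableM bh bf; have bhg := bounded_measurableM bh' bg.
pose F u := (mu1 + mu2) * (f u - g u) + lam * ((h u)%:R * f u - (h' u)%:R * g u).
have bF : bounded_measurable F.
  apply: bounded_measurableD; apply: bounded_measurableM;
    by [exact: bounded_measurable_cst|exact: bounded_measurableB].
have gfE u : 0 < u <= tau -> g u - f u = (al' - al) + I 0 u F.
  move=> u0; rewrite (gE _ u0) (fE _ u0) /F intD; last 2 first.
  - by apply: bounded_measurableM; [exact: bounded_measurable_cst|exact: bounded_measurableB].
  - by apply: bounded_measurableM; [exact: bounded_measurable_cst|exact: bounded_measurableB].
  rewrite !intZ; [|exact: bounded_measurableB..].
  by rewrite !intB//; lra.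
rewrite -subr_ge0 gfE ?s0//.
have [mF [K FK]] := bF.
apply: (nonneg_of_last_zero mF FK); [by rewrite subr_ge0|exact: ltW|].
move=> u /andP[u0 us]; rewrite -gfE; last by rewrite u0 (le_trans us).
rewrite subr_lt0 => gf.
have /andP[g0 _] := g01 u.
apply: addr_ge0.
  by apply: mulr_ge0; [rewrite ltW// addr_gt0|rewrite subr_ge0 ltW].
apply: mulr_ge0; first exact: ltW.
rewrite subr_ge0.
case: (h' u) (hh' u) => [/(_ isT) ->|_]; first by rewrite !mul1r ltW.
by rewrite mul0r mulr_ge0// (le_trans g0)// ltW.
Qed.

End Comparison.

Lemma is_cvg_linear {R : realType} (u v : R ^nat) (a b : R) :
  cvgn u -> cvgn v -> cvgn (fun n => a * u n + b * v n).
Proof.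
move=> cu cv; apply: (is_cvgD (f := fun n => a * u n) (g := fun n => b * v n)).
  exact: (is_cvgM (is_cvg_cst _) cu).
exact: (is_cvgM (is_cvg_cst _) cv).
Qed.

Section Periodic.
Context {R : realType}.
Notation mu := (@lebesgue_measure R).
Notation I a b f := (\int[mu]_(u in `]a, b]) f u).
Variables (mu1 mu2 lam tau : R).
Hypotheses (mu1_gt0 : 0 < mu1) (mu2_gt0 : 0 < mu2) (lam_gt0 : 0 < lam).
Hypothesis tau_gt0 : 0 < tau.

Definition opp_periodic (h : R -> bool) : Prop :=
  measurable_fun setT h /\ forall u, h (u + tau) = h u.

(** [p] is the probability of state 1 just before each instant, under a policy
    that leaves this state when [h] holds at unscheduled opportunities, and
    when [b] holds at scheduled ones. *)
Definition balanced (h : R -> bool) (b : bool) (p : R -> R) : Prop :=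
  [/\ measurable_fun setT p, forall u, 0 <= p u <= 1, p 0 = 0 &
    forall (M : nat) T, M%:R * tau < T -> T <= M.+1%:R * tau ->
      p T + mu1 * I 0 T p + lam * I 0 T (fun u => (h u)%:R * p u)
      + \sum_(m < M) (b%:R * p (m.+1%:R * tau)) = mu2 * I 0 T (fun u => 1 - p u)].

Section OnePolicy.
Variables (h : R -> bool) (b : bool) (p : R -> R).
Hypotheses (ph : opp_periodic h) (hp : balanced h b p).
Notation at_ M := (M%:R * tau).

Let mp : measurable_fun setT p. Proof. by case: hp. Qed.
Let p01 u : 0 <= p u <= 1. Proof. by case: hp. Qed.
Let bp : bounded_measurable p. Proof. exact: bounded_measurable01. Qed.
Let bh : bounded_measurable (fun u => (h u)%:R : R).
Proof. by apply: bounded_measurable_bool; case: ph. Qed.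
Let bhp : bounded_measurable (fun u => (h u)%:R * p u).
Proof. exact: bounded_measurableM. Qed.
Let b1p : bounded_measurable (fun u => 1 - p u).
Proof. by apply: bounded_measurableB => //; exact: bounded_measurable_cst. Qed.

Lemma at_ge0 (M : nat) : 0 <= at_ M.
Proof. by rewrite mulr_ge0// ltW. Qed.

Lemma at_S (M : nat) : at_ M.+1 = at_ M + tau.
Proof. by rewrite -natr1 mulrDl mul1r. Qed.

Lemma periodic_at (M : nat) u : h (at_ M + u) = h u.
Proof.
elim: M => [|M IH]; first by rewrite mul0r add0r.
by rewrite at_S addrAC; case: ph => _ ->.
Qed.

(** The sum counts a replacement at [at_ M], which comes after the state that
    [p] describes there: hence the correction. *)
Lemma balanced_at (M : nat) :
  p (at_ M) + mu1 * I 0 (at_ M) p + lam * I 0 (at_ M) (fun u => (h u)%:R * p u)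
  + \sum_(m < M) (b%:R * p (at_ m.+1)) - b%:R * p (at_ M)
  = mu2 * I 0 (at_ M) (fun u => 1 - p u).
Proof.
case: hp => _ _ p0 bal; case: M => [|M].
  rewrite mul0r set_itv_ge ?bnd_simp ?ltxx// !Rintegral_set0 big_ord0 p0.
  by rewrite !mulr0 !addr0 subr0.
rewrite -(bal M); last 2 first.
- by rewrite ltr_pM2r// ltr_nat.
- exact: lexx.
by rewrite big_ord_recr/= -!addrA subrr addr0.
Qed.

Lemma int_compl a c : a <= c -> I a c (fun u => 1 - p u) = (c - a) - I a c p.
Proof.
move=> ac; rewrite intB//; last exact: bounded_measurable_cst.
by rewrite int_cst// mul1r.
Qed.

Lemma int_period (M : nat) f s : bounded_measurable f -> 0 <= s ->
  I 0 (at_ M + s) f = I 0 (at_ M) f + I 0 s (fun u => f (at_ M + u)).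
Proof.
move=> bf s0; rewrite (int_split bf (at_ge0 M) (c := at_ M + s)) ?lerDl//.
by rewrite int_shift.
Qed.

Lemma period_solution (M : nat) :
  solution mu1 mu2 lam tau h ((~~ b)%:R * p (at_ M)) (fun u => p (at_ M + u)).
Proof.
split; [by case: (bounded_measurable_shift (at_ M) bp)|by move=> u|].
move=> s /andP[s0 st].
have sM : at_ M < at_ M + s by rewrite ltrDl.
have sS : at_ M + s <= at_ M.+1 by rewrite at_S lerD2l.
have [_ _ _ /(_ M _ sM sS)] := hp.
rewrite !int_period ?(ltW s0)//.
have -> : I 0 s (fun u => 1 - p (at_ M + u)) = s - I 0 s (fun u => p (at_ M + u)).
  rewrite intB; [|exact: bounded_measurable_cst|exact: bounded_measurable_shift].
  by rewrite int_cst ?(ltW s0)// mul1r subr0.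
have -> : I 0 s (fun u => (h (at_ M + u))%:R * p (at_ M + u)) =
          I 0 s (fun u => (h u)%:R * p (at_ M + u)).
  by apply: eq_Rintegral => u _; rewrite periodic_at.
have := balanced_at M; case: (b) => /=; lra.
Qed.

(** Since the first period starts in state 2, state 1 is at least as likely in
    the second one as in the first one, and the comparison of two periods
    propagates to all later ones. *)
Lemma period_nondecreasing (M : nat) s : 0 < s <= tau ->
  p (at_ M + s) <= p (at_ M.+1 + s).
Proof.
have [mh _] := ph.
have step (N : nat) : p (at_ N) <= p (at_ N.+1) ->
    forall s, 0 < s <= tau -> p (at_ N + s) <= p (at_ N.+1 + s).
  move=> pN; apply: (solution_le mu1_gt0 mu2_gt0 lam_gt0 mh mh _ _
    (period_solution N) (period_solution N.+1)) => //.
  by rewrite ler_wpM2l.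
elim: M s => [|M IH]; apply: step.
  have -> : p (at_ 0%N) = 0 by rewrite mul0r; case: hp.
  by case/andP: (p01 (at_ 1%N)).
by rewrite [at_ M.+2]at_S {1}at_S; apply: IH; rewrite tau_gt0 lexx.
Qed.

(** By [period_nondecreasing] these integrals increase with the rank [M] of the
    period, and they are bounded by its length. *)
Lemma period_integral_cvg (w : R -> bool) : measurable_fun setT w ->
  cvgn (fun M => I 0 tau (fun u => (w u)%:R * p (at_ M + u))).
Proof.
move=> mw; have bw := bounded_measurable_bool mw.
have bwp (M : nat) : bounded_measurable (fun u => (w u)%:R * p (at_ M + u)).
  by apply: bounded_measurableM => //; exact: bounded_measurable_shift.
apply: nondecreasing_is_cvgn.
  apply/nondecreasing_seqP => M; apply: int_le => // u ut.
  by apply: ler_wpM2l => //; exact: period_nondecreasing.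
exists tau => _ [M _ <-].
apply: (@le_trans _ _ (I 0 tau (fun=> 1))); last first.
  by rewrite int_cst ?(ltW tau_gt0)// mul1r subr0.
apply: int_le => //; first exact: bounded_measurable_cst.
move=> u _; have /andP[p0 p1] := p01 (at_ M + u).
by case: (w u); rewrite ?mul1r ?mul0r.
Qed.

Lemma so_cvg : cvgn (fun M => p (at_ M.+1)).
Proof.
apply: nondecreasing_is_cvgn.
  apply/nondecreasing_seqP => M; rewrite [at_ M.+2]at_S {1}at_S.
  by apply: period_nondecreasing; rewrite tau_gt0 lexx.
by exists 1 => _ [M _ <-]; case/andP: (p01 (at_ M.+1)).
Qed.

Variables (h' : R -> bool) (b' : bool) (cp cc : R).
Hypothesis ph' : opp_periodic h'.

(** Expected cost of the first [M] periods; [h'] and [b'] tell when the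
    component is replaced in state 2. *)
Definition period_cost (M : nat) : R :=
  cc * (mu1 * I 0 (at_ M) p)
  + cp * ((lam * I 0 (at_ M) (fun u => (h' u)%:R * (1 - p u))
           + \sum_(m < M) (b'%:R * (1 - p (at_ m.+1))))
          + (lam * I 0 (at_ M) (fun u => (h u)%:R * p u)
             + \sum_(m < M) (b%:R * p (at_ m.+1)))).

(** The cost of one period converges with its rank, hence so do its averages. *)
Lemma period_cost_mean_cvg :
  exists c : R, (fun M : nat => period_cost M.+1 / M.+1%:R) @ \oo --> c.
Proof.
pose A M := I 0 tau (fun u => true%:R * p (at_ M + u)).
pose B M := I 0 tau (fun u => (h u)%:R * p (at_ M + u)).
pose B' M := I 0 tau (fun u => (h' u)%:R * p (at_ M + u)).
pose incr M := cc * (mu1 * A M) + cp * ((lam * (I 0 tau (fun u => (h' u)%:R) - B' M)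
   + b'%:R * (1 - p (at_ M.+1))) + (lam * B M + b%:R * p (at_ M.+1))).
have mh : measurable_fun setT h by case: ph.
have [mh' h'per] := ph'.
have bh' := bounded_measurable_bool mh'.
have h'at (M : nat) u : h' (at_ M + u) = h' u.
  elim: M => [|M IH]; first by rewrite mul0r add0r.
  by rewrite at_S addrAC h'per.
have bh'p : bounded_measurable (fun u => (h' u)%:R * (1 - p u)).
  exact: bounded_measurableM.
have cA : cvgn A by apply: (period_integral_cvg (w := fun=> true)).
have cB : cvgn B by exact: period_integral_cvg.
have cB' : cvgn B' by exact: period_integral_cvg.
pose P M := p (at_ M.+1); have cP : cvgn P := so_cvg.
pose one : nat -> R := fun=> 1; have c1 : cvgn one by exact: is_cvg_cst.
have cincr : cvgn incr.
  have := is_cvg_linear (a := 1) (b := 1)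
    (is_cvg_linear (a := cc * mu1) (b := - (cp * lam)) cA cB')
    (is_cvg_linear (a := 1) (b := cp * (lam * I 0 tau (fun u => (h' u)%:R) + b'%:R))
      (is_cvg_linear (a := cp * lam) (b := cp * (b%:R - b'%:R)) cB cP) c1).
  by congr (cvgn _); apply/funext => M; rewrite /incr /P /one; ring.
have costE M : period_cost M = \sum_(0 <= k < M) incr k.
  elim: M => [|M IH].
    rewrite big_geq// /period_cost mul0r set_itv_ge ?bnd_simp ?ltxx//.
    by rewrite !Rintegral_set0 !big_ord0 !(mulr0, addr0).
  have intS f : bounded_measurable f ->
      I 0 (at_ M.+1) f = I 0 (at_ M) f + I 0 tau (fun u => f (at_ M + u)).
    by move=> bf; rewrite at_S int_period// ltW.
  rewrite big_nat_recr//= -IH /period_cost /incr !big_ord_recr/=.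
  rewrite (intS _ bp) (intS _ bhp) (intS _ bh'p).
  have -> : A M = I 0 tau (fun u => p (at_ M + u)).
    by apply: eq_Rintegral => u _; rewrite mul1r.
  have -> : I 0 tau (fun u => (h' (at_ M + u))%:R * (1 - p (at_ M + u))) =
     I 0 tau (fun u => (h' u)%:R) - B' M.
    rewrite -intB//; last by apply: bounded_measurableM => //; exact: bounded_measurable_shift.
    by apply: eq_Rintegral => u _; rewrite h'at mulrBr mulr1.
  have -> : I 0 tau (fun u => (h (at_ M + u))%:R * p (at_ M + u)) = B M.
    by apply: eq_Rintegral => u _; rewrite periodic_at.
  by ring.
move/cvg_ex : cincr => [c /cesaro cc_]; exists c.
rewrite (_ : (fun M => _) = arithmetic_mean incr)//.
by apply/funext => M; rewrite /arithmetic_mean/= mulrC costE.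
Qed.

End OnePolicy.
End Periodic.

Section CostComparison.
Context {R : realType}.
Notation mu := (@lebesgue_measure R).
Notation I a b f := (\int[mu]_(u in `]a, b]) f u).
Variables (mu1 mu2 lam tau cp cc : R).
Hypotheses (mu1_gt0 : 0 < mu1) (mu2_gt0 : 0 < mu2) (lam_gt0 : 0 < lam).
Hypotheses (tau_gt0 : 0 < tau) (cp_gt0 : 0 < cp).
Notation at_ M := (M%:R * tau).
Notation balanced := (balanced mu1 mu2 lam tau).
Notation period_cost := (period_cost mu1 lam tau).
Notation opp_periodic := (opp_periodic tau).

(** Every entry into state 1, except one that is not over yet, ends in a failure
    or in a replacement in state 1, so the number of these replacements is
    determined by those of the entries and of the failures. *)
Lemma period_costE h b p h' b' M : balanced h b p ->
  period_cost h b p h' b' cp cc M =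
  (mu1 * cc - (mu1 + mu2) * cp) * I 0 (at_ M) p + cp * mu2 * at_ M
  - cp * ((~~ b)%:R * p (at_ M))
  + cp * (lam * I 0 (at_ M) (fun u => (h' u)%:R * (1 - p u))
           + \sum_(m < M) (b'%:R * (1 - p (at_ m.+1)))).
Proof.
move=> hp; have [mp p01 _ _] := hp.
have bp := bounded_measurable01 mp p01.
have := balanced_at tau_gt0 hp M.
rewrite (int_compl hp (at_ge0 tau_gt0 M)) subr0 /period_cost => bal.
have -> : lam * I 0 (at_ M) (fun u => (h u)%:R * p u)
    + \sum_(m < M) (b%:R * p (at_ m.+1)) = mu2 * (at_ M - I 0 (at_ M) p)
    - p (at_ M) - mu1 * I 0 (at_ M) p + b%:R * p (at_ M) by lra.
by case: (b) => /=; ring.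
Qed.

Lemma period_cost_ge h b p h' b' M : balanced h b p ->
  (mu1 * cc - (mu1 + mu2) * cp) * I 0 (at_ M) p + cp * mu2 * at_ M - cp
  <= period_cost h b p h' b' cp cc M.
Proof.
move=> hp; rewrite (period_costE _ _ _ hp).
have [mp p01 _ _] := hp.
have := p01 (at_ M) => /andP[pM0 pM1].
have h1 : cp * ((~~ b)%:R * p (at_ M)) <= cp.
  by rewrite -[leRHS]mulr1 ler_wpM2l ?(ltW cp_gt0)//; case: (b); rewrite ?mul0r ?mul1r.
have h2 : 0 <= cp * (lam * I 0 (at_ M) (fun u => (h' u)%:R * (1 - p u))
           + \sum_(m < M) (b'%:R * (1 - p (at_ m.+1)))).
  apply: mulr_ge0; first exact: ltW.
  apply: addr_ge0.
    apply: mulr_ge0; [exact: ltW|apply: int_ge0 => u _].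
    by rewrite mulr_ge0// subr_ge0; case/andP: (p01 u).
  by apply: sumr_ge0 => m _; rewrite mulr_ge0// subr_ge0; case/andP: (p01 (at_ m.+1)).
lra.
Qed.

Lemma period_cost_le h b p M : balanced h b p ->
  period_cost h b p xpred0 false cp cc M <=
  (mu1 * cc - (mu1 + mu2) * cp) * I 0 (at_ M) p + cp * mu2 * at_ M.
Proof.
move=> hp; rewrite (period_costE _ _ _ hp).
have [mp p01 _ _] := hp.
have := p01 (at_ M) => /andP[pM0 _].
have -> : I 0 (at_ M) (fun u => (xpred0 u)%:R * (1 - p u)) = 0.
  under eq_Rintegral do rewrite mul0r.
  by rewrite int_cst ?mul0r// at_ge0.
rewrite big1; last by move=> m _; rewrite mul0r.
rewrite mulr0 addr0 mulr0 addr0 lerBlDr lerDl.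
by apply: mulr_ge0; [exact: ltW|case: (b); rewrite ?mul0r ?mul1r].
Qed.

(** Replacing at every opportunity minimises the time spent in state 1: each
    period then starts in state 2 and [solution_le] compares the two policies
    within that period. *)
Lemma occupation_replace_le h b p q M :
  opp_periodic h -> balanced h b p -> balanced xpredT true q ->
  I 0 (at_ M) q <= I 0 (at_ M) p.
Proof.
move=> ph hp hq; have [mp p01 _ _] := hp; have [mq q01 _ _] := hq.
have bp := bounded_measurable01 mp p01; have bq := bounded_measurable01 mq q01.
have pT : opp_periodic xpredT by split.
elim: M => [|M IH]; first by rewrite mul0r set_itv_ge ?bnd_simp ?ltxx// !Rintegral_set0.
rewrite at_S !int_period ?(ltW tau_gt0)// lerD// int_le//;
  [exact: bounded_measurable_shift|exact: bounded_measurable_shift|].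
have [mh _] := ph; have [mT _] := pT.
apply: (solution_le mu1_gt0 mu2_gt0 lam_gt0 mT mh _ _
  (period_solution tau_gt0 pT hq M) (period_solution tau_gt0 ph hp M)) => //.
rewrite mul0r mulr_ge0//; by case/andP: (p01 (at_ M)).
Qed.

(** Never replacing maximises, up to a constant, the time spent in state 1: then
    failures are the only exits from it, and in the long run there are as many
    of them as of entries. *)
Lemma occupation_never_ge h b p q M :
  balanced h b p -> balanced xpred0 false q ->
  (mu1 + mu2) * I 0 (at_ M) p <= (mu1 + mu2) * I 0 (at_ M) q + 1.
Proof.
move=> hp hq; have [mp p01 _ _] := hp; have [mq q01 _ _] := hq.
have := balanced_at tau_gt0 hq M; have := balanced_at tau_gt0 hp M.
rewrite (int_compl hp (at_ge0 tau_gt0 M)) (int_compl hq (at_ge0 tau_gt0 M)).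
have -> : I 0 (at_ M) (fun u => (xpred0 u)%:R * q u) = 0.
  under eq_Rintegral do rewrite mul0r.
  by rewrite int_cst ?mul0r// at_ge0.
have -> : \sum_(m < M) (false%:R * q (at_ m.+1)) = 0.
  by rewrite big1// => m _; rewrite mul0r.
have /andP[pM0 pM1] := p01 (at_ M); have /andP[qM0 qM1] := q01 (at_ M).
have Ihp : 0 <= lam * I 0 (at_ M) (fun u => (h u)%:R * p u).
  apply: mulr_ge0; [exact: ltW|apply: int_ge0 => u _].
  by rewrite mulr_ge0//; case/andP: (p01 u).
have Sp : 0 <= \sum_(m < M) (b%:R * p (at_ m.+1)).
  by apply: sumr_ge0 => m _; rewrite mulr_ge0//; case/andP: (p01 (at_ m.+1)).
have bpM : b%:R * p (at_ M) <= p (at_ M) by case: (b); rewrite ?mul0r ?mul1r.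
rewrite mulr0 addr0 mul0r !subr0; lra.
Qed.

(** By [period_costE] the cost is, up to a term common to all policies, a bounded
    term and the price of replacements in state 2, the time spent in state 1
    with the coefficient [mu1 * cc - (mu1 + mu2) * cp]: the threshold makes this
    time minimal or maximal according to the sign of the coefficient. *)
Lemma threshold_cost_le h b p h' b' q :
  opp_periodic h -> balanced h b p ->
  let r := (mu1 + mu2) * cp < mu1 * cc in
  balanced (fun=> r) r q ->
  exists K : R, forall M, period_cost (fun=> r) r q xpred0 false cp cc M <=
                          period_cost h b p h' b' cp cc M + K.
Proof.
move=> ph hp /=; case: ltP => [k_gt0|k_le0] hq.
  (* a visit to state 1 costs more than the replacement that prevents it; the
     constant is the price of the replacement that [p] may owe at the end *)
  exists cp => M.
  have h1 := period_cost_le M hq.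
  have h2 := period_cost_ge h' b' M hp.
  have h3 := occupation_replace_le M ph hp hq.
  have k0 : 0 <= mu1 * cc - (mu1 + mu2) * cp by lra.
  have := ler_wpM2l k0 h3; lra.
(* the second term is the coefficient of the time in state 1, times the excess
   of this time over its maximum that [occupation_never_ge] allows *)
exists (cp + ((mu1 + mu2) * cp - mu1 * cc) / (mu1 + mu2)) => M.
have h1 := period_cost_le M hq.
have h2 := period_cost_ge h' b' M hp.
have mu12 : 0 < mu1 + mu2 by exact: addr_gt0.
have h3 : I 0 (at_ M) p <= I 0 (at_ M) q + 1 / (mu1 + mu2).
  have := occupation_never_ge M hp hq.
  by rewrite -ler_pdivlMl// mulrDr mulKf ?gt_eqF// mulr1 mul1r.
have k0 : 0 <= (mu1 + mu2) * cp - mu1 * cc by lra.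
have := ler_wpM2l k0 h3; rewrite mulrDr mul1r; lra.
Qed.

End CostComparison.

(** * Long-run averages *)

Section LongRun.
Context {R : realType} (tau : R).
Hypothesis tau_gt0 : 0 < tau.

Lemma truncn_cvg : (fun T : R => Num.truncn (T / tau)) @ +oo --> \oo.
Proof.
move=> A [N _ NA]; exists (N.+1%:R * tau); split; first exact: num_real.
move=> T NT /=; apply: NA => /=; rewrite -ltnS -(ltr_nat R).
have T0 : 0 <= T / tau.
  rewrite divr_ge0//; last exact: ltW.
  by rewrite (le_trans _ (ltW NT))// mulr_ge0// ltW.
rewrite (lt_le_trans _ (ltW (truncnS_gt _)))//.
by rewrite ltr_pdivlMr// (le_lt_trans _ NT)// ler_pM2r// ler_nat.
Qed.

(** A nondecreasing cost has a long-run average as soon as it has one along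
    the scheduled opportunities. *)
Lemma long_run_average (C : R -> \bar R) (y : R ^nat) (c : R) :
  {homo C : s t / s <= t >-> (s <= t)%E} ->
  (forall M : nat, C (M%:R * tau) = (y M)%:E) -> (forall M, 0 <= y M) ->
  (fun M : nat => y M.+1 / M.+1%:R) @ \oo --> c ->
  (fun T : R => (T^-1)%:E * C T)%E @ +oo --> (c / tau)%:E.
Proof.
move=> Cmono CE y0 yc.
pose lo (M : nat) : R := y M / (M.+1%:R * tau).
pose hi (M : nat) : R := y M.+1 / (M%:R * tau).
have harm := @cvg_harmonic R.
have lo_cvg : lo @ \oo --> c / tau.
  suff : [sequence lo n.+1]_n @ \oo --> c / tau by rewrite (cvg_shiftS lo).
  have -> : [sequence lo n.+1]_n =
      (fun M => y M.+1 / M.+1%:R * (1 - harmonic M.+1) * tau^-1).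
    apply/funext => M; rewrite /lo /harmonic/=; field.
    by rewrite gt_eqF//= -natrD nat1r !pnatr_eq0.
  have h : (fun M => harmonic M.+1 : R) @ \oo --> (0 : R) by rewrite cvg_shiftS.
  have h1 : (fun M => 1 - harmonic M.+1 : R) @ \oo --> (1 - 0 : R).
    exact: (cvgB (cvg_cst _) h).
  have := cvgM (cvgM yc h1) (cvg_cst tau^-1).
  rewrite subr0 mulr1 => H; exact: H.
have hi_cvg : hi @ \oo --> c / tau.
  suff : [sequence hi n.+1]_n @ \oo --> c / tau by rewrite (cvg_shiftS hi).
  have -> : [sequence hi n.+1]_n =
      (fun M => y M.+2 / M.+2%:R * (1 + harmonic M) * tau^-1).
    apply/funext => M; rewrite /hi /harmonic/=; field.
    by rewrite gt_eqF//= -natrD nat1r !pnatr_eq0.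
  have yc1 : (fun M => y M.+2 / M.+2%:R) @ \oo --> c.
    by rewrite (cvg_shiftS (fun M => y M.+1 / M.+1%:R)).
  have h1 : (fun M => 1 + harmonic M : R) @ \oo --> (1 + 0 : R).
    exact: (cvgD (cvg_cst _) harm).
  have := cvgM (cvgM yc1 h1) (cvg_cst tau^-1).
  by rewrite addr0 mulr1 => H; exact: H.
have := @squeeze_cvge _ _ _ _ (fun T => (lo (Num.truncn (T / tau)))%:E)
   (fun T => (T^-1)%:E * C T)%E (fun T => (hi (Num.truncn (T / tau)))%:E).
apply.
- exists tau; split; first exact: num_real.
  move=> T tauT; set M := Num.truncn (T / tau).
  have T0 : 0 < T by exact: lt_trans tauT.
  have MT : M%:R * tau <= T.
    by rewrite -ler_pdivlMr// truncn_le// divr_ge0// ltW.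
  have TM : T <= M.+1%:R * tau.
    by rewrite -ler_pdivrMr// ltW// truncnS_gt.
  have M0 : (0 < M)%N.
    by rewrite truncn_gt_nat ler_pdivlMr// mul1r ltW.
  have := Cmono _ _ MT; have := Cmono _ _ TM; rewrite !CE => CT1 CT2.
  apply/andP; split.
    apply: (@le_trans _ _ ((T^-1)%:E * (y M)%:E)%E).
      rewrite -EFinM lee_fin /lo mulrC ler_wpM2r// lef_pV2//.
      by rewrite posrE mulr_gt0.
    by rewrite lee_wpmul2l// lee_fin invr_ge0 ltW.
  apply: (@le_trans _ _ ((T^-1)%:E * (y M.+1)%:E)%E).
    by rewrite lee_wpmul2l// lee_fin invr_ge0 ltW.
  rewrite -EFinM lee_fin /hi mulrC ler_wpM2l// lef_pV2//.
  by rewrite posrE mulr_gt0// ltr0n.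
- apply: cvg_EFin; first exact: nearW.
  exact: (cvg_comp _ _ truncn_cvg lo_cvg).
- apply: cvg_EFin; first exact: nearW.
  exact: (cvg_comp _ _ truncn_cvg hi_cvg).
Qed.

End LongRun.

(** * From almost surely positive to positive clocks *)

Section PositiveClocks.
Context {R : realType} {d : measure_display} {Omega : measurableType d}.
Variables (P : probability Omega R) (I : eqType) (X : I -> {RV P >-> R}).
Variable (rate : I -> R).
Hypotheses (rate_gt0 : forall c, 0 < rate c) (indep : mutually_independent X).
Hypothesis law : forall c, has_exponential_law (rate c) (X c).

(** A clock that is positive everywhere, and not only almost surely, spares an
    exceptional set in each statement on trajectories; 1 is arbitrary. *)
Definition make_positive (y : R) : R := if 0 < y then y else 1.

Lemma measurable_make_positive : measurable_fun setT make_positive.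
Proof. by apply: measurable_fun_ifT => //; exact: measurable_fun_ltr. Qed.

Let measurable_positive c : measurable_fun setT (make_positive \o X c).
Proof. by apply: (measurableT_comp measurable_make_positive). Qed.

Definition positive_clock c : {RV P >-> R} :=
  HB.pack_for {mfun Omega >-> R} (make_positive \o X c)
    (isMeasurableFun.Build _ _ _ _ _ (measurable_positive c)).

Lemma positive_clock_gt0 c w : 0 < positive_clock c w.
Proof. by rewrite /= /make_positive; case: ifP. Qed.

Lemma ae_clock_gt0 c : {ae P, forall w, positive_clock c w = X c w}.
Proof.
have mle : measurable [set w | X c w <= 0].
  by apply: measurable_bool_set; exact: measurable_fun_ler.
have := ae_measure0 mle (exponential_le0 (law c)).
by apply: filterS => w /= /negP; rewrite -ltNge /make_positive => ->.
Qed.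

Lemma positive_clock_indep : mutually_independent positive_clock.
Proof.
move=> J A uJ mA; apply: (indep (A := fun i => make_positive @^-1` A i)) => // i.
by rewrite -[Y in measurable Y]setTI; apply: measurable_make_positive.
Qed.

Lemma positive_clock_law c : has_exponential_law (rate c) (positive_clock c).
Proof.
move=> A mA; rewrite -law//.
change (P (positive_clock c @^-1` A) = P (X c @^-1` A)).
have mpre (Z : {RV P >-> R}) : measurable (Z @^-1` A).
  by rewrite -[_ @^-1` _]setTI; exact: measurable_funP.
apply: measure_ae_iff; [exact: mpre|exact: mpre|].
by move: (ae_clock_gt0 c); apply: filterS => w /= ->.
Qed.

End PositiveClocks.

Section TotalCost.
Context {R : realType} d (T : measurableType d) (X : clock -> T -> R).
Variables (tau cp cc : R) (pi : policy R).
Hypotheses (tau_gt0 : 0 < tau) (mpi : measurable_policy tau pi).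
Hypotheses (mX : forall c, measurable_fun setT (X c)) (cp_gt0 : 0 < cp) (cc_gt0 : 0 < cc).

Definition cost_until (S : R) (t : T) : \bar R :=
  total_cost tau cp cp cc pi (sojourn2 (X^~ t)) (sojourn1 (X^~ t)) (gap (X^~ t)) S.

Let cost k t : R :=
  if inst tau pi (X^~ t) k.+1 == fail tau pi (X^~ t) k then cc else cp.

Let cost_ge0 k t : 0 <= cost k t.
Proof. by rewrite /cost; case: ifP => _; exact: ltW. Qed.

Lemma cost_untilE S t : cost_until S t =
  (\sum_(k <oo) (if inst tau pi (X^~ t) k.+1 <= S then cost k t else 0)%:E)%E.
Proof.
rewrite /cost_until /total_cost eseries_mkcond; apply: eq_eseriesr => k _.
rewrite /cost /replacement_cost.
rewrite (_ : install_time _ _ _ _ _ k.+1 = inst tau pi (X^~ t) k.+1)//.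
rewrite (_ : failure_time _ _ _ _ _ k = fail tau pi (X^~ t) k)// if_same.
by case: ifP.
Qed.

Lemma cost_until_ge0 S t : (0 <= cost_until S t)%E.
Proof.
rewrite cost_untilE; apply: nneseries_ge0 => k _ _.
by rewrite lee_fin; case: ifP.
Qed.

Lemma measurable_cost_until S : measurable_fun setT (cost_until S).
Proof.
rewrite (_ : cost_until S = (fun t => \sum_(k <oo)
  (if inst tau pi (X^~ t) k.+1 <= S then cost k t else 0)%:E)%E); last first.
  by apply/funext => t; exact: cost_untilE.
apply: ge0_emeasurable_sum => [k t _ _|k _]; first by rewrite lee_fin; case: ifP.
have mi := measurable_inst tau_gt0 mpi mX; have mf := measurable_fail tau_gt0 mpi mX.
apply/measurable_EFinP; apply: measurable_fun_ifT.
- exact: measurable_fun_ler.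
- by apply: measurable_fun_ifT => //; exact: measurable_fun_eqr.
- exact: measurable_cst.
Qed.

Lemma cost_until_le S S' t : S <= S' -> (cost_until S t <= cost_until S' t)%E.
Proof.
move=> SS'; rewrite !cost_untilE; apply: lee_nneseries => k _.
  by rewrite lee_fin; case: ifP.
rewrite lee_fin; case: ifP => [h|_]; last by case: ifP.
by rewrite (le_trans h SS').
Qed.

End TotalCost.

(** * Optimality *)

Section PolicyCost.
Context {R : realType} {d : measure_display} {Omega : measurableType d}.
Variables (P : probability Omega R) (x : clock -> {RV P >-> R}).
Variables (mu1 mu2 lam tau cp cc : R).
Hypotheses (mu1_gt0 : 0 < mu1) (mu2_gt0 : 0 < mu2) (lam_gt0 : 0 < lam).
Hypotheses (tau_gt0 : 0 < tau) (cp_gt0 : 0 < cp) (cc_gt0 : 0 < cc).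
Hypotheses (indep : mutually_independent x) (x_gt0 : forall c w, 0 < x c w).
Hypothesis law : forall c, has_exponential_law (rate mu1 mu2 lam c) (x c).

Definition state1_freq (pi : policy R) : R -> R := freq x tau pi Satisfactory.

Definition policy_cost (pi : policy R) (M : nat) : R :=
  period_cost mu1 lam tau
    (hit tau pi Satisfactory) (replaces pi Satisfactory SO 0) (state1_freq pi)
    (hit tau pi Perfect) (replaces pi Perfect SO 0) cp cc M.

Variable pi : policy R.
Hypothesis mpi : measurable_policy tau pi.

Lemma opp_periodic_hit i : opp_periodic tau (hit tau pi i).
Proof. by split; [exact: measurable_hit|move=> u; exact: hitD]. Qed.

Let freq_perfect_int a : \int[@lebesgue_measure R]_(u in `]0, a]) freq x tau pi Perfect u =
  \int[@lebesgue_measure R]_(u in `]0, a]) (1 - state1_freq pi u).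
Proof.
apply: eq_Rintegral => u /set_mem /=; rewrite in_itv/= => /andP[u0 _].
by rewrite (freq_perfect mu1_gt0 mu2_gt0 lam_gt0 tau_gt0 mpi indep x_gt0 law).
Qed.

Lemma state1_balanced : balanced mu1 mu2 lam tau
  (hit tau pi Satisfactory) (replaces pi Satisfactory SO 0) (state1_freq pi).
Proof.
split.
- exact: (measurable_freq mu1_gt0 mu2_gt0 lam_gt0 tau_gt0 mpi indep x_gt0 law).
- move=> u; rewrite /state1_freq (freq_ge0 mu1_gt0 mu2_gt0 lam_gt0 tau_gt0 mpi indep x_gt0 law).
  exact: (freq_le1 mu1_gt0 mu2_gt0 lam_gt0 tau_gt0 mpi indep x_gt0 law).
- by rewrite /state1_freq /freq prob_nonpos.
- move=> M T MT TM; rewrite -freq_perfect_int.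
  exact: (freq_balance mu1_gt0 mu2_gt0 lam_gt0 tau_gt0 mpi indep x_gt0 law).
Qed.

Lemma policy_costE (M : nat) :
  (\int[P]_w cost_until x tau cp cc pi (M%:R * tau) w = (policy_cost pi M)%:E)%E.
Proof.
rewrite /cost_until (expected_total_cost_so mu1_gt0 mu2_gt0 lam_gt0 tau_gt0 mpi indep x_gt0 law)//.
congr EFin; rewrite /policy_cost /period_cost; congr (_ + cp * (_ + _)).
congr (lam * _ + _).
  apply: eq_Rintegral => u /set_mem /=; rewrite in_itv/= => /andP[u0 _].
  by rewrite (freq_perfect mu1_gt0 mu2_gt0 lam_gt0 tau_gt0 mpi indep x_gt0 law).
apply: eq_bigr => m _; rewrite (freq_perfect mu1_gt0 mu2_gt0 lam_gt0 tau_gt0 mpi indep x_gt0 law)//.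
by rewrite mulr_gt0.
Qed.

Lemma policy_cost_cvg : exists c : R,
  (fun M : nat => policy_cost pi M.+1 / M.+1%:R) @ \oo --> c.
Proof.
exact: (period_cost_mean_cvg mu1_gt0 mu2_gt0 lam_gt0 tau_gt0
  (opp_periodic_hit _) state1_balanced _ _ _ (opp_periodic_hit _)).
Qed.

Lemma policy_long_run (c : R) :
  (fun M : nat => policy_cost pi M.+1 / M.+1%:R) @ \oo --> c ->
  (fun T : R => (T^-1)%:E * \int[P]_w cost_until x tau cp cc pi T w)%E @ +oo
    --> (c / tau)%:E.
Proof.
move=> cM; apply: (long_run_average tau_gt0 _ policy_costE _ cM).
  move=> S S' SS'; apply: ge0_le_integral => //.
  all: try by move=> w _; exact: cost_until_ge0.
  all: try exact: measurable_cost_until.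
  by move=> w _; exact: cost_until_le.
move=> M; rewrite -lee_fin -policy_costE; apply: integral_ge0 => w _.
exact: cost_until_ge0.
Qed.

End PolicyCost.

Section Threshold.
Context {R : realType}.
Variables (mu1 mu2 tau cp cc : R).
Notation threshold := (threshold_policy mu1 mu2 cp cc).
Notation replace1 := ((mu1 + mu2) * cp < mu1 * cc).

Lemma measurable_threshold_policy : measurable_policy tau threshold.
Proof.
move=> i j.
have -> : [set t : R | 0 <= t < tau /\ threshold i j t = Replace] =
    if replaces threshold i j 0 then `[0, tau[%classic else set0.
  rewrite /replaces; case: i => /=; first by rewrite -subset0 => t [].
  case: (_ < _); last by rewrite -subset0 => t [].
  by rewrite eqEsubset; split => t /=; rewrite in_itv/=; [case|split].
by case: ifP => _; [exact: measurable_itv|exact: measurable0].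
Qed.

Lemma hit_threshold_perfect : hit tau threshold Perfect = xpred0.
Proof. by []. Qed.

Lemma hit_threshold_satisfactory : hit tau threshold Satisfactory = fun=> replace1.
Proof. by apply/funext => u; rewrite /hit /replaces /=; case: ifP. Qed.

Lemma replaces_threshold_satisfactory : replaces threshold Satisfactory SO 0 = replace1.
Proof. by rewrite /replaces /=; case: ifP. Qed.

End Threshold.

Theorem theorem1 (R : realType) (mu1 mu2 lam tau cso cuso cp cc : R)
    (d : measure_display) (Omega : measurableType d) (P : probability Omega R)
    (X2 X1 E : nat -> {RV P >-> R})
    (mu1_gt0 : 0 < mu1) (mu2_gt0 : 0 < mu2) (lam_gt0 : 0 < lam)
    (tau_gt0 : 0 < tau)
    (cso_eq : cso = cp) (cuso_eq : cuso = cp)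
    (cp_gt0 : 0 < cp) (cp_lt_cc : cp < cc)
    (model : replacement_model mu1 mu2 lam X2 X1 E) :
  long_run_average_cost_optimal tau cso cuso cc X2 X1 E
    (threshold_policy mu1 mu2 cp cc).
Proof.
subst cso cuso; case: model => law2 law1 lawE indep.
have cc_gt0 : 0 < cc by exact: lt_trans cp_lt_cc.
pose X (c : clock) : {RV P >-> R} := match c with
  | inl (inl k) => X2 k | inl (inr k) => X1 k | inr n => E n end.
have lawX c : has_exponential_law (rate mu1 mu2 lam c) (X c).
  by case: c => [[k|k]|n]; [exact: law2|exact: law1|exact: lawE].
have rate_gt0 c : 0 < rate mu1 mu2 lam c by case: c => [[k|k]|n].
pose x := positive_clock X.
have lawx c : has_exponential_law (rate mu1 mu2 lam c) (x c).
  exact: (positive_clock_law lawX).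
have indepx : mutually_independent x by exact: (positive_clock_indep (X := X)).
have x_gt0 c w : 0 < x c w by exact: positive_clock_gt0.
have xX : {ae P, forall w, forall c, x c w = X c w}.
  have ae_nat (f : nat -> clock) : {ae P, forall w, forall k, x (f k) w = X (f k) w}.
    by apply/ae_foralln => k; exact: (ae_clock_gt0 lawX).
  have h2 := ae_nat (fun k => inl (inl k)); have h1 := ae_nat (fun k => inl (inr k)).
  have hE := ae_nat inr.
  by move: h2 h1 hE; apply: filterS3 => w h2 h1 hE [[k|k]|n].
have costE pi T : measurable_policy tau pi ->
    expected_cost tau cp cp cc X2 X1 E pi T =
    (\int[P]_w cost_until x tau cp cc pi T w)%E.
  move=> mpi; rewrite /expected_cost.
  transitivity (\int[P]_w cost_until X tau cp cc pi T w)%E; first by [].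
  apply: ge0_ae_eq_integral => //.
  all: try by move=> w _; exact: cost_until_ge0.
  all: try exact: measurable_cost_until.
  move: xX; apply: filterS => w h _; rewrite /cost_until.
  by have -> : (X^~ w) = (x^~ w) by apply/funext => c; rewrite -h.
have long_run pi (c : R) : measurable_policy tau pi ->
    (fun M : nat => policy_cost x mu1 lam tau cp cc pi M.+1 / M.+1%:R) @ \oo --> c ->
    is_long_run_average_cost tau cp cp cc X2 X1 E pi (c / tau).
  move=> mpi cM; rewrite /is_long_run_average_cost.
  under eq_fun do rewrite costE//.
  exact: (policy_long_run mu1_gt0 mu2_gt0 lam_gt0).
pose thr := threshold_policy mu1 mu2 cp cc.
have mthr : measurable_policy tau thr by exact: measurable_threshold_policy.
have [c0 cvg0] := policy_cost_cvg cp cc mu1_gt0 mu2_gt0 lam_gt0 tau_gt0 indepx x_gt0 lawx mthr.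
split; first exact: mthr.
exists (c0 / tau); split; first exact: long_run.
move=> pi mpi.
have [c cvgc] := policy_cost_cvg cp cc mu1_gt0 mu2_gt0 lam_gt0 tau_gt0 indepx x_gt0 lawx mpi.
exists (c / tau); split; first exact: long_run.
rewrite ler_pM2r ?invr_gt0//.
have balanced_thr := state1_balanced mu1_gt0 mu2_gt0 lam_gt0 tau_gt0 indepx x_gt0 lawx mthr.
have balanced_pi := state1_balanced mu1_gt0 mu2_gt0 lam_gt0 tau_gt0 indepx x_gt0 lawx mpi.
rewrite hit_threshold_satisfactory replaces_threshold_satisfactory in balanced_thr.
have [K HK] := threshold_cost_le mu1_gt0 mu2_gt0 lam_gt0 tau_gt0 cp_gt0
  (hit tau pi Perfect) (replaces pi Perfect SO 0) (opp_periodic_hit tau_gt0 mpi Satisfactory)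
  balanced_pi balanced_thr.
have cvgK : (fun M : nat => policy_cost x mu1 lam tau cp cc pi M.+1 / M.+1%:R
    + K * harmonic M) @ \oo --> c.
  have := cvgD cvgc (cvgM (cvg_cst K) (@cvg_harmonic R)).
  by rewrite mulr0 addr0 => H; exact: H.
apply: (ler_cvg_to cvg0 cvgK); apply: nearW => M.
rewrite /harmonic/= -mulrDl ler_pM2r ?invr_gt0//.
have := HK M.+1; rewrite /policy_cost hit_threshold_satisfactory.
by rewrite hit_threshold_perfect replaces_threshold_satisfactory.
Qed.
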